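(* Let $k$ be an algebraically closed field of positive characteristic $p$. (1) Let $(\varphi^*,\omega^* )$ be a pair of the form $(\nu)$, where $\nu\in\{\mathrm{I},\mathrm{II},\ldots,\mathrm{XXVI}\}$. Then the morphism $\psi_{\varphi^*,\omega^*}:\mathbb{G}_a\rtimes\mathbb{G}_m\to\mathrm{SL}(4,k)$ is a homomorphism and $\omega^*\in\Omega(4)$. (2) Let $\psi:\mathrm{B}(2,k)\to\mathrm{SL}(4,k)$ be an antisymmetric homomorphism, and express it as $\psi\circ\jmath=\psi_{\varphi,\omega}$ with $(\varphi,\omega)\in\mathcal{U}_4\times\Omega(4)$. Then there exists $(\varphi^*,\omega^* )\in\mathcal{U}_4\times\Omega(4)$ such that (a) $(\varphi,\omega)\sim(\varphi^*,\omega^* )$, and (b) $(\varphi^*,\omega^* )$ has one of the forms $(\mathrm{I})$–$(\mathrm{XXVI})$.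
   Context: $\mathbb{G}_a$, $\mathbb{G}_m$ are the additive and multiplicative groups of $k$; $\mathrm{B}(2,k)\subset\mathrm{SL}(2,k)$ is the subgroup of upper triangular matrices. $\mathbb{G}_a\rtimes\mathbb{G}_m$ has product $(t,u)\cdot(t',u')=(t+u^2t',uu')$, and $\jmath:\mathbb{G}_a\rtimes\mathbb{G}_m\to\mathrm{B}(2,k)$ is the isomorphism $\jmath(t,u)=\begin{pmatrix}1&t\\0&1\end{pmatrix}\begin{pmatrix}u&0\\0&u^{-1}\end{pmatrix}$. All homomorphisms are homomorphisms of algebraic groups. For morphisms $\varphi:\mathbb{G}_a\to\mathrm{SL}(n,k)$, $\omega:\mathbb{G}_m\to\mathrm{SL}(n,k)$, put $\psi_{\varphi,\omega}(t,u):=\varphi(t)\,\omega(u)$. $\mathcal{U}_n$ is the set of homomorphisms $\varphi:\mathbb{G}_a\to\mathrm{SL}(n,k)$ such that every $\varphi(t)$ is upper triangular with all diagonal entries $1$. $\Omega(n)$ is the set of homomorphisms $\omega:\mathbb{G}_m\to\mathrm{SL}(n,k)$ of the form $\omega(u)=\mathrm{diag}(u^{d_1},\ldots,u^{d_n})$ with integers $d_1\ge\cdots\ge d_n$, $d_i=-d_{n-i+1}$ for all $i$. A homomorphism $\psi:\mathrm{B}(2,k)\to\mathrm{SL}(n,k)$ is antisymmetric if $u\mapsto\psi(\mathrm{diag}(u,u^{-1}))$ belongs to $\Omega(n)$. Pairs satisfy $(\varphi,\omega)\sim(\varphi^*,\omega^* )$ if there is $P\in\mathrm{GL}(n,k)$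 with $P^{-1}\psi_{\varphi,\omega}(t,u)P=\psi_{\varphi^*,\omega^*}(t,u)$ for all $(t,u)$. A pair $(\varphi^*,\omega^* )$ has the form $(\nu)$ if $\omega^*(u)=\mathrm{diag}(u^{d_1},u^{d_2},u^{-d_2},u^{-d_1})$ and the integers $d_1,d_2$ and $\varphi^*$ are as follows, for some integer parameters (all $e_i\geq 0$) satisfying the listed conditions; $E_{ij}$ are the $4\times4$ matrix units and $I=I_4$: (I) $p\ge5$; $d_1=3p^{e_1}$, $d_2=p^{e_1}$; $\varphi^*(t)=I+t^{p^{e_1}}(E_{12}+E_{23}+E_{34})+\frac12t^{2p^{e_1}}(E_{13}+E_{24})+\frac16t^{3p^{e_1}}E_{14}$. (II) $p=3$; $d_1=p^{e_1+1}$, $d_2=p^{e_1}$; $\varphi^*(t)=I+t^{p^{e_1}}(E_{12}+E_{23})+\frac12t^{2p^{e_1}}E_{13}+t^{p^{e_1+1}}E_{14}$. (III) $p\ge3$; $d_1=3p^{e_1}$, $d_2=p^{e_1}$; $\varphi^*(t)=I+t^{p^{e_1}}(E_{12}+E_{23})+\frac12t^{2p^{e_1}}E_{13}$. (IV) $e_2>e_1\ge0$; $d_1=p^{e_1}+p^{e_2}$, $d_2=p^{e_2}-p^{e_1}$; $\varphi^*(t)=I+t^{p^{e_1}}(E_{12}+E_{34})+t^{p^{e_2}}(E_{13}+E_{24})+t^{p^{e_1}+p^{e_2}}E_{14}$. (V) $e_1\ge0$, $f\ge e_1+1$; $d_1=p^f$, $d_2=p^f-2p^{e_1}$; $\varphi^*(t)=I+t^{p^{e_1}}(E_{12}+E_{34})+t^{p^f}E_{14}$.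 (VI) $d_1=d_2+2p^{e_1}$, $d_2\ge0$; $\varphi^*(t)=I+t^{p^{e_1}}(E_{12}+E_{34})$. (VII) $p=3$; $d_1=p^{e_1+1}$, $d_2=p^{e_1}$; $\varphi^*(t)=I+t^{p^{e_1}}(E_{23}+E_{34})+\frac12t^{2p^{e_1}}E_{24}+t^{p^{e_1+1}}E_{14}$. (VIII) $p\ge3$; $d_1=3p^{e_1}$, $d_2=p^{e_1}$; $\varphi^*(t)=I+t^{p^{e_1}}(E_{23}+E_{34})+\frac12t^{2p^{e_1}}E_{24}$. (IX) $p\ge3$; $d_1=2p^{e_1}$, $d_2=0$; $\varphi^*(t)=I+t^{p^{e_1}}(E_{12}+E_{24})+\frac12t^{2p^{e_1}}E_{14}$. (X) $e_2>e_1\ge0$; $d_1=p^{e_1}+p^{e_2}$, $d_2=p^{e_2}-p^{e_1}$; $\varphi^*(t)=I+t^{p^{e_1}}E_{12}+t^{p^{e_2}}E_{13}$. (XI) $e_1\ge0$, $e_3\ge e_1+1$; $d_1=p^{e_3}$, $d_2=p^{e_3}-2p^{e_1}$; $\varphi^*(t)=I+t^{p^{e_1}}E_{12}+t^{p^{e_3}}E_{14}$. (XII) $d_1=2p^{e_1}+d_2$, $d_2\ge0$; $\varphi^*(t)=I+t^{p^{e_1}}E_{12}$. (XIII) $e_1>e_3\ge0$; $d_1=2p^{e_1}-p^{e_3}$, $d_2=p^{e_3}$; $\varphi^*(t)=I+t^{p^{e_1}}(E_{13}+E_{24})+t^{p^{e_3}}E_{23}$. (XIV) $e_1>e_3\ge0$;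 $d_1=2p^{e_1}-p^{e_3}$, $d_2=p^{e_3}$; $\varphi^*(t)=I+t^{p^{e_1}}E_{13}+t^{p^{e_3}}E_{23}$. (XV) $e_2\ge e_3\ge0$; $d_1=p^{e_2}$, $d_2=p^{e_3}$; $\varphi^*(t)=I+t^{p^{e_2}}E_{14}+t^{p^{e_3}}E_{23}$. (XVI) $e_4>e_3\ge0$; $d_1=2p^{e_4}-p^{e_3}$, $d_2=p^{e_3}$; $\varphi^*(t)=I+t^{p^{e_3}}E_{23}+t^{p^{e_4}}E_{24}$. (XVII) $d_1\ge p^{e_3}$, $d_2=p^{e_3}$; $\varphi^*(t)=I+t^{p^{e_3}}E_{23}$. (XVIII) $e_2>e_1\ge0$; $d_1=p^{e_1}+p^{e_2}$, $d_2=p^{e_2}-p^{e_1}$; $\varphi^*(t)=I+t^{p^{e_2}}E_{24}+t^{p^{e_1}}E_{34}$. (XIX) $e_1\ge0$, $e_3\ge e_1+1$; $d_1=p^{e_3}$, $d_2=p^{e_3}-2p^{e_1}$; $\varphi^*(t)=I+t^{p^{e_3}}E_{14}+t^{p^{e_1}}E_{34}$. (XX) $d_1=2p^{e_1}+d_2$, $d_2\ge0$; $\varphi^*(t)=I+t^{p^{e_1}}E_{34}$. (XXI) $p=2$; $d_1=p^{e_1+1}$, $d_2=0$; $\varphi^*(t)=I+t^{p^{e_1}}(E_{13}+E_{24})+t^{p^{e_1+1}}E_{14}$. (XXII) $2p^{e_1}\ge d_1\ge p^{e_1}$, $d_2=2p^{e_1}-d_1$; $\varphi^*(t)=I+t^{p^{e_1}}(E_{13}+E_{24})$.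 (XXIII) $2p^{e_1}\ge d_1\ge p^{e_1}$, $d_2=2p^{e_1}-d_1$; $\varphi^*(t)=I+t^{p^{e_1}}E_{13}$. (XXIV) $d_1=p^{e_2}$, $p^{e_2}\ge d_2\ge0$; $\varphi^*(t)=I+t^{p^{e_2}}E_{14}$. (XXV) $2p^{e_3}\ge d_1\ge p^{e_3}$, $d_2=2p^{e_3}-d_1$; $\varphi^*(t)=I+t^{p^{e_3}}E_{24}$. (XXVI) $d_1\ge d_2\ge0$; $\varphi^*(t)=I$. *)

(* Defs.v *)
From HB Require Import structures.
From mathcomp Require Import all_boot all_order all_algebra.
From mathcomp Require Import mpoly ring.

Set Implicit Arguments.
Unset Strict Implicit.
Unset Printing Implicit Defensive.

Import Order.TTheory GRing.Theory Num.Theory.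

Local Open Scope ring_scope.

(* A group given as a closed subvariety of an affine space over k: [coord x i]
   is the i-th affine coordinate of the point x.  Over an algebraically closed
   field, regular functions are identified with the functions on points that
   are polynomials in these coordinates. *)
HB.mixin Record hasCoord (k : fieldType) (G : Type) := {
  ncoord : nat;
  coord : G -> 'I_ncoord -> k
}.

#[short(type="algGroupType")]
HB.structure Definition AlgGroup (k : fieldType) :=
  {G of hasCoord k G & Group G}.

Section Morphisms.
Variable k : fieldType.

Definition regular_fun (G : algGroupType k) (f : G -> k) : Prop :=
  exists q : {mpoly k[@ncoord k G]}, forall x, f x = q.@[coord x].

Definition alg_hom (G H : algGroupType k) (f : G -> H) : Prop :=
  (forall i, regular_fun (fun x => coord (f x) i))
  /\ {morph f : x y / (x * y)%g}.

End Morphisms.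

(* The additive group. *)
Section AdditiveGroup.
Variable k : fieldType.

Definition Ga : Type := k.
HB.instance Definition _ := Choice.copy Ga k.
HB.instance Definition _ := isGroup.Build Ga
  (@addrA k) (@add0r k) (@addr0 k) (@addNr k) (@addrN k).
HB.instance Definition _ := hasCoord.Build k Ga (fun t (_ : 'I_1) => t : k).

End AdditiveGroup.

(* The multiplicative group, embedded in the affine plane by u |-> (u, u^-1). *)
Section MultiplicativeGroup.
Variable k : fieldType.

Record Gm : Type := MkGm { Gm_val :> k; Gm_neq0 : Gm_val != 0 }.

HB.instance Definition _ := [isSub for Gm_val].
HB.instance Definition _ := [Choice of Gm by <:].

Definition Gm_one : Gm := MkGm (oner_neq0 k).

Fact Gm_mul_proof (u v : Gm) : (u : k) * (v : k) != 0.
Proof. by rewrite mulf_neq0 ?Gm_neq0. Qed.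
Definition Gm_mul (u v : Gm) : Gm := MkGm (Gm_mul_proof u v).

Fact Gm_inv_proof (u : Gm) : (u : k)^-1 != 0.
Proof. by rewrite invr_eq0 Gm_neq0. Qed.
Definition Gm_inv (u : Gm) : Gm := MkGm (Gm_inv_proof u).

Fact Gm_mulA : associative Gm_mul.
Proof. by move=> u v w; apply: val_inj; rewrite /= mulrA. Qed.
Fact Gm_mul1 : left_id Gm_one Gm_mul.
Proof. by move=> u; apply: val_inj; rewrite /= mul1r. Qed.
Fact Gm_1mul : right_id Gm_one Gm_mul.
Proof. by move=> u; apply: val_inj; rewrite /= mulr1. Qed.
Fact Gm_mulV : left_inverse Gm_one Gm_inv Gm_mul.
Proof. by move=> u; apply: val_inj; rewrite /= mulVf ?Gm_neq0. Qed.
Fact Gm_Vmul : right_inverse Gm_one Gm_inv Gm_mul.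
Proof. by move=> u; apply: val_inj; rewrite /= mulfV ?Gm_neq0. Qed.

HB.instance Definition _ :=
  isGroup.Build Gm Gm_mulA Gm_mul1 Gm_1mul Gm_mulV Gm_Vmul.
HB.instance Definition _ := hasCoord.Build k Gm
  (fun (u : Gm) (i : 'I_2) => if i == 0 then u : k else (u : k)^-1).

End MultiplicativeGroup.

(* The semidirect product, with coordinates (t, u, u^-1). *)
Section SemidirectProduct.
Variable k : fieldType.

Record GaGm : Type := MkGaGm { add_part : Ga k; mul_part : Gm k }.

Definition GaGm_pair (x : GaGm) := (add_part x, mul_part x).
Definition pair_GaGm (x : Ga k * Gm k) := MkGaGm x.1 x.2.
Fact GaGm_pairK : cancel GaGm_pair pair_GaGm. Proof. by case. Qed.
HB.instance Definition _ := Choice.copy GaGm (can_type GaGm_pairK).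

Definition GaGm_one : GaGm := MkGaGm (0 : k) (Gm_one k).
Definition GaGm_mul (x y : GaGm) : GaGm :=
  let: MkGaGm t u := x in let: MkGaGm t' u' := y in
  MkGaGm ((t : k) + (u : k) ^+ 2 * (t' : k)) (u * u')%g.
Definition GaGm_inv (x : GaGm) : GaGm :=
  let: MkGaGm t u := x in MkGaGm (- ((u : k) ^- 2 * (t : k))) u^-1%g.

Fact GaGm_mulA : associative GaGm_mul.
Proof.
move=> [t u] [t' u'] [t'' u'']; rewrite /GaGm_mul mulgA; congr MkGaGm.
by rewrite /= exprMn mulrDr !addrA mulrA.
Qed.
Fact GaGm_mul1 : left_id GaGm_one GaGm_mul.
Proof.
by case=> t u; congr MkGaGm; rewrite ?mul1g //= expr1n mul1r add0r.
Qed.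
Fact GaGm_1mul : right_id GaGm_one GaGm_mul.
Proof. by case=> t u; congr MkGaGm; rewrite ?mulg1 //= mulr0 addr0. Qed.
Fact GaGm_mulV : left_inverse GaGm_one GaGm_inv GaGm_mul.
Proof.
by case=> t u; congr MkGaGm; rewrite ?mulVg //= exprVn addNr.
Qed.
Fact GaGm_Vmul : right_inverse GaGm_one GaGm_inv GaGm_mul.
Proof.
case=> t u; congr MkGaGm; rewrite ?mulgV //= mulrN mulrA.
by rewrite mulfV ?mul1r ?subrr // expf_neq0 ?Gm_neq0.
Qed.

HB.instance Definition _ := isGroup.Build GaGm
  GaGm_mulA GaGm_mul1 GaGm_1mul GaGm_mulV GaGm_Vmul.
HB.instance Definition _ := hasCoord.Build k GaGm
  (fun (x : GaGm) (i : 'I_3) =>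
     nth 0 [:: add_part x : k; mul_part x : k; (mul_part x : k)^-1] i).

End SemidirectProduct.

(* SL(n,k), with the matrix entries as coordinates. *)
Section SpecialLinear.
Variables (k : fieldType) (n : nat).

Record SL : Type := MkSL { SL_val :> 'M[k]_n; SL_det : \det SL_val == 1 }.

HB.instance Definition _ := [isSub for SL_val].
HB.instance Definition _ := [Choice of SL by <:].

Fact SL_one_proof : \det (1%:M : 'M[k]_n) == 1.
Proof. by rewrite det1. Qed.
Definition SL_one : SL := MkSL SL_one_proof.

Fact SL_mul_proof (A B : SL) : \det ((A : 'M[k]_n) *m B) == 1.
Proof. by rewrite det_mulmx !(eqP (SL_det _)) mulr1. Qed.
Definition SL_mul (A B : SL) : SL := MkSL (SL_mul_proof A B).

Fact SL_inv_proof (A : SL) : \det (invmx (A : 'M[k]_n)) == 1.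
Proof. by rewrite det_inv (eqP (SL_det A)) invr1. Qed.
Definition SL_inv (A : SL) : SL := MkSL (SL_inv_proof A).

Fact SL_unit (A : SL) : (A : 'M[k]_n) \in unitmx.
Proof. by rewrite unitmxE (eqP (SL_det A)) unitr1. Qed.

Fact SL_mulA : associative SL_mul.
Proof. by move=> A B C; apply: val_inj; rewrite /= mulmxA. Qed.
Fact SL_mul1 : left_id SL_one SL_mul.
Proof. by move=> A; apply: val_inj; rewrite /= mul1mx. Qed.
Fact SL_1mul : right_id SL_one SL_mul.
Proof. by move=> A; apply: val_inj; rewrite /= mulmx1. Qed.
Fact SL_mulV : left_inverse SL_one SL_inv SL_mul.
Proof. by move=> A; apply: val_inj; rewrite /= mulVmx ?SL_unit. Qed.
Fact SL_Vmul : right_inverse SL_one SL_inv SL_mul.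
Proof. by move=> A; apply: val_inj; rewrite /= mulmxV ?SL_unit. Qed.

HB.instance Definition _ :=
  isGroup.Build SL SL_mulA SL_mul1 SL_1mul SL_mulV SL_Vmul.
HB.instance Definition _ := hasCoord.Build k SL
  (fun (A : SL) (i : 'I_(n * n)) => mxvec (A : 'M[k]_n) 0 i).

End SpecialLinear.

(* B(2,k), with the matrix entries as coordinates. *)
Section Borel.
Variable k : fieldType.

Definition upper2 (A : SL k 2) : bool := A 1 0 == 0.

Record B2 : Type := MkB2 { B2_val :> SL k 2; B2_upper : upper2 B2_val }.

HB.instance Definition _ := [isSub for B2_val].
HB.instance Definition _ := [Choice of B2 by <:].

Fact upper2_closed : group_closed upper2.
Proof.
have inv10 (A : SL k 2) : (A^-1)%g 1 0 = - A 1 0.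
  rewrite /= /invmx SL_unit (eqP (SL_det A)) invr1 scale1r mxE /cofactor.
  rewrite det_mx11 !mxE expr1 mulN1r.
  by congr (- A _ _); apply: val_inj.
split=> [|A B]; rewrite !unfold_in /upper2; first by rewrite mxE.
move=> /eqP A0 /eqP B0; rewrite mxE big_ord_recl big_ord1.
have -> : lift ord0 ord0 = 1 :> 'I_2 by apply: val_inj.
by rewrite (_ : ord0 = 0) // A0 mul0r add0r inv10 B0 oppr0 mulr0.
Qed.

HB.instance Definition _ :=
  SubChoice_isSubGroup.Build (SL k 2) upper2 B2 upper2_closed.
HB.instance Definition _ := hasCoord.Build k B2
  (fun (A : B2) (i : 'I_(2 * 2)) => mxvec (A : 'M[k]_2) 0 i).

Definition mx2 (a b c d : k) : 'M[k]_2 :=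
  \matrix_(i, j) nth 0 (nth [::] [:: [:: a; b]; [:: c; d]] i) j.

Fact det_mx2 a b c d : \det (mx2 a b c d) = a * d - b * c.
Proof.
rewrite (expand_det_row _ 0) big_ord_recl big_ord1 /cofactor !det_mx11 !mxE /=.
by rewrite expr0 expr1 mul1r mulN1r mulrN.
Qed.

Fact mul_mx2 a b c d a' b' c' d' : mx2 a b c d *m mx2 a' b' c' d' =
  mx2 (a * a' + b * c') (a * b' + b * d') (c * a' + d * c') (c * b' + d * d').
Proof.
by apply/matrixP => -[[|[|//]] ?] [[|[|//]] ?];
  rewrite !mxE big_ord_recl big_ord1 !mxE.
Qed.

Fact unip2_det t : \det (mx2 1 t 0 1) == 1.
Proof. by rewrite det_mx2 mulr1 mulr0 subr0. Qed.
Fact unip2_upper t : upper2 (MkSL (unip2_det t)).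
Proof. by rewrite /upper2 mxE. Qed.
Definition unip2 (t : Ga k) : B2 := MkB2 (unip2_upper t).

Fact diag2_det (u : Gm k) : \det (mx2 u 0 0 (u : k)^-1) == 1.
Proof. by rewrite det_mx2 mul0r subr0 mulfV ?Gm_neq0. Qed.
Fact diag2_upper u : upper2 (MkSL (diag2_det u)).
Proof. by rewrite /upper2 mxE. Qed.
Definition diag2 (u : Gm k) : B2 := MkB2 (diag2_upper u).

Definition jmath (x : GaGm k) : B2 :=
  (unip2 (add_part x) * diag2 (mul_part x))%g.

End Borel.

Section Representations.
Variables (k : fieldType) (n : nat).
Implicit Types (phi : Ga k -> SL k n) (omega : Gm k -> SL k n).

Definition psi_pair phi omega (x : GaGm k) : SL k n :=
  (phi (add_part x) * omega (mul_part x))%g.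

Definition in_U phi : Prop :=
  alg_hom phi /\
  forall t, (forall i, phi t i i = 1) /\
            (forall i j : 'I_n, (j < i)%N -> phi t i j = 0).

Definition in_Omega omega : Prop :=
  alg_hom omega /\
  exists d : 'I_n -> int,
    [/\ forall i j : 'I_n, (i <= j)%N -> d j <= d i,
        forall i, d i = - d (rev_ord i)
      & forall u : Gm k,
          omega u = diag_mx (\row_i (u : k) ^ d i) :> 'M[k]_n].

Definition antisymmetric_hom (psi : B2 k -> SL k n) : Prop :=
  alg_hom psi /\ in_Omega (fun u => psi (diag2 u)).

Definition equiv_pair phi omega phi' omega' : Prop :=
  exists2 P : 'M[k]_n, P \in unitmx &
    forall x : GaGm k,
      invmx P *m psi_pair phi omega x *m P = psi_pair phi' omega' x.

End Representations.

(* A decomposition psi o jmath = psi_pair phi omega with phi in U_n and omega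
   in Omega(n) exists for every antisymmetric homomorphism. *)
Section Decomposition.
Variables (k : closedFieldType) (n : nat).

Fact jmath_morph : {morph @jmath k : x y / (x * y)%g}.
Proof.
move=> [t u] [t' u']; do 2!apply: val_inj.
rewrite /= !mul_mx2 !(mul1r, mul0r, mulr0, mulr1, add0r, addr0).
have u0 := Gm_neq0 u; have v0 := Gm_neq0 u'.
congr mx2; field; by rewrite ?u0 ?v0.
Qed.

Lemma regular_comp (G H : algGroupType k) (g : G -> H) (f : H -> k) :
  (forall i, regular_fun (fun x => coord (g x) i)) -> regular_fun f ->
  regular_fun (fun x => f (g x)).
Proof.
move=> /fin_all_exists[r rP] [q qP]; exists (q \mPo [tuple r i | i < _]) => x.
rewrite comp_mpoly_meval qP; apply: meval_eq => i.
by rewrite tnth_mktuple rP.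
Qed.

Lemma regular_Ga (f : Ga k -> k) :
  regular_fun f -> exists q : {poly k}, forall t : k, f t = q.[t].
Proof.
case=> q qP; exists (\sum_(m <- msupp q) q@_m *: \prod_i 'X^(m i)) => t.
rewrite qP mevalE horner_sum; apply: eq_bigr => m _.
rewrite hornerZ horner_prod; congr (_ * _); apply: eq_bigr => i _.
by rewrite hornerXn.
Qed.

Lemma unip2_hom : alg_hom (@unip2 k).
Proof.
split=> [i|s t]; last first.
  do 2!apply: val_inj; rewrite /= mul_mx2.
  by rewrite !(mul1r, mul0r, mulr0, mulr1, add0r, addr0) addrC.
case/mxvec_indexP: i => i j.
exists (nth 0 (nth [::] [:: [:: 1; 'X_0]; [:: 0; 1]] i) j) => t.
rewrite /coord /= mxvecE mxE.
by case: i j => -[|[|//]] ? [[|[|//]] ?] /=;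
  rewrite ?meval0 ?meval1 ?mevalXU.
Qed.

Lemma diag2_unip2 (u : Gm k) (t : k) :
  (diag2 u * unip2 t = unip2 (Gm_val u ^+ 2 * t)%R * diag2 u)%g.
Proof.
do 2!apply: val_inj; rewrite /= !mul_mx2.
rewrite !(mul1r, mul0r, mulr0, mulr1, add0r, addr0); congr mx2.
by rewrite mulrAC expr2 mulfK ?Gm_neq0.
Qed.

Lemma poly_ext0 (q : {poly k}) : (forall x, x != 0 -> q.[x] = 0) -> q = 0.
Proof.
move=> q0; apply/eqP; rewrite -[_ == _]orFb -(polyX_eq0 k) -mulf_eq0.
apply: contraT => /closed_nonrootP[x]; rewrite /root hornerM hornerX.
by have [->|/q0->] := eqVneq x 0; rewrite ?mul0r ?mulr0 eqxx.
Qed.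

Lemma antisymmetric_decomposition (psi : B2 k -> SL k n) :
  antisymmetric_hom psi ->
  exists phi omega, [/\ in_U phi, in_Omega omega
    & forall x, psi (jmath x) = psi_pair phi omega x].
Proof.
move=> [[psi_reg psiM] Om]; pose phi t := psi (unip2 t).
exists phi, (fun u => psi (diag2 u)); split=> //; last first.
  by move=> x; rewrite psiM.
have phi_hom : alg_hom phi.
  split=> [i|s t]; last by rewrite /phi (unip2_hom.2 s t) psiM.
  exact: (regular_comp unip2_hom.1 (psi_reg i)).
split=> //.
have phi1 : phi 0 = 1%g.
  have e : phi 0 = (phi 0 * phi 0)%g by rewrite -phi_hom.2 [(_ * _)%g]addr0.
  by apply: (mulgI (phi 0)); rewrite mulg1 -e.
have {Om} [_ [d [d_le _ omE]]] := Om.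
have wt (u : Gm k) (t : k) (i j : 'I_n) :
    phi (Gm_val u ^+ 2 * t) i j * Gm_val u ^ d j = Gm_val u ^ d i * phi t i j.
  have := congr1 psi (diag2_unip2 u t); rewrite !psiM.
  move/(congr1 (fun A : SL k n => (A : 'M_n) i j)).
  by rewrite /= omE mul_diag_mx mul_mx_diag !mxE => ->.
have phi_poly i j : exists q : {poly k}, forall t : k, phi t i j = q.[t].
  have [q qP] := regular_Ga (phi_hom.1 (mxvec_index i j)).
  by exists q => t; rewrite -qP /coord /= mxvecE.
have zero (i j : 'I_n) (t : k) : (j <= i)%N -> phi t i j = (i == j)%:R.
  move=> ji; have [q qP] := phi_poly i j.
  have [m dm] : exists m : nat, d j = d i + m%:Z.
    exists `|d j - d i|%N; rewrite gez0_abs ?subr_ge0 ?d_le //.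
    by rewrite [RHS]addrC subrK.
  pose r := 'X^m * (q \Po ('X^2 * t%:P)) - q.[t]%:P.
  have r0 : r = 0.
    apply: poly_ext0 => x x0; pose u := MkGm x0.
    rewrite /r !hornerE horner_comp !hornerE -!qP.
    have := wt u t i j; rewrite /= dm expfzDr // mulrCA mulrA mulrAC.
    rewrite -mulrA => /(mulfI _) -> //; first by rewrite subrr.
    by rewrite expfz_neq0.
  have := congr1 (fun p : {poly k} => p.[0]) r0.
  rewrite /r !hornerE horner_comp !hornerE !expr0n mul0r -!qP phi1 mxE.
  have [m0 /eqP|m0 /eqP] := eqVneq m 0%N.
    by rewrite mul1r subr_eq0 => /eqP.
  rewrite mul0r sub0r oppr_eq0 => /eqP ->; case: eqVneq => // ij.
  by move: dm m0; rewrite ij -[LHS]addr0 => /addrI[<-].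
move=> t; split=> [i|i j ji]; first by rewrite zero ?eqxx.
by rewrite zero 1?ltnW // -val_eqE gtn_eqF.
Qed.

End Decomposition.

Inductive form_label : Type :=
  | fI | fII | fIII | fIV | fV | fVI | fVII | fVIII | fIX | fX
  | fXI | fXII | fXIII | fXIV | fXV | fXVI | fXVII | fXVIII | fXIX | fXX
  | fXXI | fXXII | fXXIII | fXXIV | fXXV | fXXVI.

Section Forms.
Variables (k : fieldType) (p : nat).

(* The 4 x 4 matrix units, with indices from 1 to 4. *)
Definition E (i j : nat) : 'M[k]_4 := delta_mx (inord i.-1) (inord j.-1).

Definition diag4 (d1 d2 : int) (u : k) : 'M[k]_4 :=
  diag_mx (\row_i nth 0 [:: u ^ d1; u ^ d2; u ^ (- d2); u ^ (- d1)] i).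

Definition form_cond (nu : form_label) (d1 d2 : int) (phi : k -> 'M[k]_4) :
    Prop :=
  let q (e : nat) : nat := (p ^ e)%N in
  let z (e : nat) : int := p%:Z ^+ e in
  match nu with
  | fI => (5 <= p)%N /\ exists e1 : nat,
      [/\ d1 = 3 * z e1, d2 = z e1
        & forall t, phi t = 1%:M
            + t ^+ q e1 *: (E 1 2 + E 2 3 + E 3 4)
            + (2^-1 * t ^+ (2 * q e1)) *: (E 1 3 + E 2 4)
            + (6^-1 * t ^+ (3 * q e1)) *: E 1 4]
  | fII => p = 3%N /\ exists e1 : nat,
      [/\ d1 = z e1.+1, d2 = z e1
        & forall t, phi t = 1%:M
            + t ^+ q e1 *: (E 1 2 + E 2 3)
            + (2^-1 * t ^+ (2 * q e1)) *: E 1 3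
            + t ^+ q e1.+1 *: E 1 4]
  | fIII => (3 <= p)%N /\ exists e1 : nat,
      [/\ d1 = 3 * z e1, d2 = z e1
        & forall t, phi t = 1%:M
            + t ^+ q e1 *: (E 1 2 + E 2 3)
            + (2^-1 * t ^+ (2 * q e1)) *: E 1 3]
  | fIV => exists e1 e2 : nat,
      [/\ (e1 < e2)%N, d1 = z e1 + z e2, d2 = z e2 - z e1
        & forall t, phi t = 1%:M
            + t ^+ q e1 *: (E 1 2 + E 3 4)
            + t ^+ q e2 *: (E 1 3 + E 2 4)
            + t ^+ (q e1 + q e2) *: E 1 4]
  | fV => exists e1 f : nat,
      [/\ (e1.+1 <= f)%N, d1 = z f, d2 = z f - 2 * z e1
        & forall t, phi t = 1%:M
            + t ^+ q e1 *: (E 1 2 + E 3 4)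
            + t ^+ q f *: E 1 4]
  | fVI => exists e1 : nat,
      [/\ d1 = d2 + 2 * z e1, 0 <= d2
        & forall t, phi t = 1%:M + t ^+ q e1 *: (E 1 2 + E 3 4)]
  | fVII => p = 3%N /\ exists e1 : nat,
      [/\ d1 = z e1.+1, d2 = z e1
        & forall t, phi t = 1%:M
            + t ^+ q e1 *: (E 2 3 + E 3 4)
            + (2^-1 * t ^+ (2 * q e1)) *: E 2 4
            + t ^+ q e1.+1 *: E 1 4]
  | fVIII => (3 <= p)%N /\ exists e1 : nat,
      [/\ d1 = 3 * z e1, d2 = z e1
        & forall t, phi t = 1%:M
            + t ^+ q e1 *: (E 2 3 + E 3 4)
            + (2^-1 * t ^+ (2 * q e1)) *: E 2 4]
  | fIX => (3 <= p)%N /\ exists e1 : nat,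
      [/\ d1 = 2 * z e1, d2 = 0
        & forall t, phi t = 1%:M
            + t ^+ q e1 *: (E 1 2 + E 2 4)
            + (2^-1 * t ^+ (2 * q e1)) *: E 1 4]
  | fX => exists e1 e2 : nat,
      [/\ (e1 < e2)%N, d1 = z e1 + z e2, d2 = z e2 - z e1
        & forall t, phi t = 1%:M
            + t ^+ q e1 *: E 1 2 + t ^+ q e2 *: E 1 3]
  | fXI => exists e1 e3 : nat,
      [/\ (e1.+1 <= e3)%N, d1 = z e3, d2 = z e3 - 2 * z e1
        & forall t, phi t = 1%:M
            + t ^+ q e1 *: E 1 2 + t ^+ q e3 *: E 1 4]
  | fXII => exists e1 : nat,
      [/\ d1 = 2 * z e1 + d2, 0 <= d2
        & forall t, phi t = 1%:M + t ^+ q e1 *: E 1 2]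
  | fXIII => exists e1 e3 : nat,
      [/\ (e3 < e1)%N, d1 = 2 * z e1 - z e3, d2 = z e3
        & forall t, phi t = 1%:M
            + t ^+ q e1 *: (E 1 3 + E 2 4) + t ^+ q e3 *: E 2 3]
  | fXIV => exists e1 e3 : nat,
      [/\ (e3 < e1)%N, d1 = 2 * z e1 - z e3, d2 = z e3
        & forall t, phi t = 1%:M
            + t ^+ q e1 *: E 1 3 + t ^+ q e3 *: E 2 3]
  | fXV => exists e2 e3 : nat,
      [/\ (e3 <= e2)%N, d1 = z e2, d2 = z e3
        & forall t, phi t = 1%:M
            + t ^+ q e2 *: E 1 4 + t ^+ q e3 *: E 2 3]
  | fXVI => exists e3 e4 : nat,
      [/\ (e3 < e4)%N, d1 = 2 * z e4 - z e3, d2 = z e3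
        & forall t, phi t = 1%:M
            + t ^+ q e3 *: E 2 3 + t ^+ q e4 *: E 2 4]
  | fXVII => exists e3 : nat,
      [/\ z e3 <= d1, d2 = z e3
        & forall t, phi t = 1%:M + t ^+ q e3 *: E 2 3]
  | fXVIII => exists e1 e2 : nat,
      [/\ (e1 < e2)%N, d1 = z e1 + z e2, d2 = z e2 - z e1
        & forall t, phi t = 1%:M
            + t ^+ q e2 *: E 2 4 + t ^+ q e1 *: E 3 4]
  | fXIX => exists e1 e3 : nat,
      [/\ (e1.+1 <= e3)%N, d1 = z e3, d2 = z e3 - 2 * z e1
        & forall t, phi t = 1%:M
            + t ^+ q e3 *: E 1 4 + t ^+ q e1 *: E 3 4]
  | fXX => exists e1 : nat,
      [/\ d1 = 2 * z e1 + d2, 0 <= d2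
        & forall t, phi t = 1%:M + t ^+ q e1 *: E 3 4]
  | fXXI => p = 2%N /\ exists e1 : nat,
      [/\ d1 = z e1.+1, d2 = 0
        & forall t, phi t = 1%:M
            + t ^+ q e1 *: (E 1 3 + E 2 4) + t ^+ q e1.+1 *: E 1 4]
  | fXXII => exists e1 : nat,
      [/\ z e1 <= d1 <= 2 * z e1, d2 = 2 * z e1 - d1
        & forall t, phi t = 1%:M + t ^+ q e1 *: (E 1 3 + E 2 4)]
  | fXXIII => exists e1 : nat,
      [/\ z e1 <= d1 <= 2 * z e1, d2 = 2 * z e1 - d1
        & forall t, phi t = 1%:M + t ^+ q e1 *: E 1 3]
  | fXXIV => exists e2 : nat,
      [/\ d1 = z e2, 0 <= d2 <= z e2
        & forall t, phi t = 1%:M + t ^+ q e2 *: E 1 4]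
  | fXXV => exists e3 : nat,
      [/\ z e3 <= d1 <= 2 * z e3, d2 = 2 * z e3 - d1
        & forall t, phi t = 1%:M + t ^+ q e3 *: E 2 4]
  | fXXVI => 0 <= d2 <= d1 /\ forall t, phi t = 1%:M
  end.

Definition has_form (nu : form_label)
    (phi : Ga k -> SL k 4) (omega : Gm k -> SL k 4) : Prop :=
  exists d1 d2 : int,
    (forall u : Gm k, omega u = diag4 d1 d2 u :> 'M[k]_4)
    /\ form_cond nu d1 d2 (fun t : k => phi t).

End Forms.

(* Main.v *)
Require Import Defs.
From mathcomp Require Import all_boot all_order all_algebra.
From mathcomp Require Import mpoly ring zify.

Set Implicit Arguments.
Unset Strict Implicit.
Unset Printing Implicit Defensive.

Import Order.TTheory GRing.Theory Num.Theory.
Local Open Scope ring_scope.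

(* Conjugation by the torus forces every entry of phi to be a monomial,
   phi(t)_ij = c_ij t^((d_i - d_j) / 2).  Writing a = (d1 - d2) / 2 and
   b = (d1 + d2) / 2, the exponents above the diagonal are a, b, a + b, b - a,
   b, a, and additivity of phi becomes one identity in s and t per entry.  An
   entry without correction term is zero or has a power of p as exponent; for
   the others, the left-hand side is symmetric in s and t, which forces either
   a = b - a or a relation between the coefficients.  What remains is
   normalized by the centralizer of the torus: diagonal matrices in general,
   GL_2 on the two middle coordinates if d2 = 0, and GL_2 x GL_2 if d1 = d2. *)

(** The constants 1/2 and 1/6 and the conditions on [p] come from the case where two neighbouring
    entries next to the diagonal are nonzero: (1,2) and (2,3), or (2,3) and (3,4). The exponents are
    then q, 2q, 3q with q a power of p, and the identities at s = t = 1 give 2 c13 = c12 c23, 2 c24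
    = c23 c34 and, after halving, 6 c14 = c12 c23 c34. So p = 2 cannot occur there. For p = 3 the
    product c12 c23 c34 vanishes while c14 becomes free, because t^(3q) is then additive. For p >= 5
    the coefficient c14 is determined. The centralizer of the torus is the right group for
    normalizing because it leaves omega, hence d1 and d2, untouched. A diagonal matrix offers only
    three independent ratios against up to six coefficients, so the relations supplied by additivity
    must account for the rest. *)

Section Matrices.
Variable k : fieldType.

Definition mx4 (x11 x12 x13 x14 x21 x22 x23 x24
    x31 x32 x33 x34 x41 x42 x43 x44 : k) : 'M[k]_4 :=
  \matrix_(i, j) nth 0 (nth [::]
    [:: [:: x11; x12; x13; x14]; [:: x21; x22; x23; x24];
        [:: x31; x32; x33; x34]; [:: x41; x42; x43; x44]] i) j.

Lemma mul_mx4 x11 x12 x13 x14 x21 x22 x23 x24 x31 x32 x33 x34 x41 x42 x43 x44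
    y11 y12 y13 y14 y21 y22 y23 y24 y31 y32 y33 y34 y41 y42 y43 y44 :
  mx4 x11 x12 x13 x14 x21 x22 x23 x24 x31 x32 x33 x34 x41 x42 x43 x44 *m
  mx4 y11 y12 y13 y14 y21 y22 y23 y24 y31 y32 y33 y34 y41 y42 y43 y44 =
  mx4 (x11 * y11 + (x12 * y21 + (x13 * y31 + x14 * y41)))
      (x11 * y12 + (x12 * y22 + (x13 * y32 + x14 * y42)))
      (x11 * y13 + (x12 * y23 + (x13 * y33 + x14 * y43)))
      (x11 * y14 + (x12 * y24 + (x13 * y34 + x14 * y44)))
      (x21 * y11 + (x22 * y21 + (x23 * y31 + x24 * y41)))
      (x21 * y12 + (x22 * y22 + (x23 * y32 + x24 * y42)))
      (x21 * y13 + (x22 * y23 + (x23 * y33 + x24 * y43)))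
      (x21 * y14 + (x22 * y24 + (x23 * y34 + x24 * y44)))
      (x31 * y11 + (x32 * y21 + (x33 * y31 + x34 * y41)))
      (x31 * y12 + (x32 * y22 + (x33 * y32 + x34 * y42)))
      (x31 * y13 + (x32 * y23 + (x33 * y33 + x34 * y43)))
      (x31 * y14 + (x32 * y24 + (x33 * y34 + x34 * y44)))
      (x41 * y11 + (x42 * y21 + (x43 * y31 + x44 * y41)))
      (x41 * y12 + (x42 * y22 + (x43 * y32 + x44 * y42)))
      (x41 * y13 + (x42 * y23 + (x43 * y33 + x44 * y43)))
      (x41 * y14 + (x42 * y24 + (x43 * y34 + x44 * y44))).
Proof.
apply/matrixP => i j; rewrite [LHS]mxE !big_ord_recl big_ord0 addr0 !mxE /=.
by case: i j => -[|[|[|[|//]]]] ? [[|[|[|[|//]]]] ?].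
Qed.

Definition upper4 (x12 x13 x14 x23 x24 x34 : k) : 'M[k]_4 :=
  mx4 1 x12 x13 x14 0 1 x23 x24 0 0 1 x34 0 0 0 1.

Lemma mul_upper4 x12 x13 x14 x23 x24 x34 y12 y13 y14 y23 y24 y34 :
  upper4 x12 x13 x14 x23 x24 x34 *m upper4 y12 y13 y14 y23 y24 y34 =
  upper4 (x12 + y12) (x13 + y13 + x12 * y23)
    (x14 + y14 + x12 * y24 + x13 * y34) (x23 + y23)
    (x24 + y24 + x23 * y34) (x34 + y34).
Proof. by rewrite mul_mx4; congr mx4; ring. Qed.

Lemma upper4_inj x12 x13 x14 x23 x24 x34 y12 y13 y14 y23 y24 y34 :
  upper4 x12 x13 x14 x23 x24 x34 = upper4 y12 y13 y14 y23 y24 y34 ->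
  [/\ x12 = y12, x13 = y13 & x14 = y14] /\
  [/\ x23 = y23, x24 = y24 & x34 = y34].
Proof.
move=> /matrixP e; pose at4 i j := e (@inord 3 i) (@inord 3 j).
move: (at4 0%N 1%N) (at4 0%N 2%N) (at4 0%N 3%N).
move: (at4 1%N 2%N) (at4 1%N 3%N) (at4 2%N 3%N).
by rewrite !mxE !inordK.
Qed.

(** The nilpotent part of [upper4]. The listed forms are 1 plus multiples of matrix units; with the
    sum associated to the right, [form_upper4] collapses the nilpotent terms first and adds the
    identity last. *)
Definition strict4 (x12 x13 x14 x23 x24 x34 : k) : 'M[k]_4 :=
  mx4 0 x12 x13 x14 0 0 x23 x24 0 0 0 x34 0 0 0 0.

Lemma strict4D x12 x13 x14 x23 x24 x34 y12 y13 y14 y23 y24 y34 :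
  strict4 x12 x13 x14 x23 x24 x34 + strict4 y12 y13 y14 y23 y24 y34 =
  strict4 (x12 + y12) (x13 + y13) (x14 + y14) (x23 + y23) (x24 + y24)
    (x34 + y34).
Proof.
by apply/matrixP => -[[|[|[|[|//]]]] ?] [[|[|[|[|//]]]] ?];
  rewrite !mxE /= ?addr0.
Qed.

Lemma strict4Z a x12 x13 x14 x23 x24 x34 :
  a *: strict4 x12 x13 x14 x23 x24 x34 =
  strict4 (a * x12) (a * x13) (a * x14) (a * x23) (a * x24) (a * x34).
Proof.
by apply/matrixP => -[[|[|[|[|//]]]] ?] [[|[|[|[|//]]]] ?];
  rewrite !mxE /= ?mulr0.
Qed.

Lemma add1_strict4 x12 x13 x14 x23 x24 x34 :
  1%:M + strict4 x12 x13 x14 x23 x24 x34 = upper4 x12 x13 x14 x23 x24 x34.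
Proof.
by apply/matrixP => -[[|[|[|[|//]]]] ?] [[|[|[|[|//]]]] ?];
  rewrite !mxE /= ?addr0 ?add0r.
Qed.

Lemma upper4_1 : 1%:M = upper4 0 0 0 0 0 0.
Proof.
by apply/matrixP => -[[|[|[|[|//]]]] ?] [[|[|[|[|//]]]] ?]; rewrite !mxE.
Qed.

Lemma E_strict4 :
  (E k 1 2 = strict4 1 0 0 0 0 0) * (E k 1 3 = strict4 0 1 0 0 0 0) *
  (E k 1 4 = strict4 0 0 1 0 0 0) * (E k 2 3 = strict4 0 0 0 1 0 0) *
  (E k 2 4 = strict4 0 0 0 0 1 0) * (E k 3 4 = strict4 0 0 0 0 0 1).
Proof.
by do ![split]; apply/matrixP => -[[|[|[|[|//]]]] ?] [[|[|[|[|//]]]] ?];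
  rewrite !mxE -!val_eqE /= !inordK.
Qed.

Definition form_upper4 := (E_strict4, strict4Z, strict4D, add1_strict4).

End Matrices.

(** * Homomorphisms with monomial entries *)

Section RegularFunctions.
Variables (k : fieldType) (G : algGroupType k).

Lemma regular_const (c : k) : regular_fun (fun _ : G => c).
Proof. by exists c%:MP => x; rewrite mevalC. Qed.

Lemma regular_coord i : regular_fun (fun x : G => Defs.coord x i).
Proof. by exists 'X_i => x; rewrite mevalXU. Qed.

Lemma regularM (f g : G -> k) :
  regular_fun f -> regular_fun g -> regular_fun (fun x => f x * g x).
Proof.
by move=> [q qP] [r rP]; exists (q * r) => x; rewrite mevalM -qP -rP.
Qed.

Lemma regularX (f : G -> k) m :
  regular_fun f -> regular_fun (fun x => f x ^+ m).
Proof. by move=> [q qP]; exists (q ^+ m) => x; rewrite rmorphXn /= -qP. Qed.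

Lemma regular_ext (f g : G -> k) :
  f =1 g -> regular_fun f -> regular_fun g.
Proof. by move=> fg [q qP]; exists q => x; rewrite -fg. Qed.

(** Negative powers are regular only because the inverse is itself a coordinate; [g] stands for that
    coordinate on [Gm] and on [GaGm]. *)
Lemma regular_exprz (f : G -> k) (g : G -> k) (z : int) :
  (forall x, g x = (f x)^-1) -> regular_fun f -> regular_fun g ->
  regular_fun (fun x => f x ^ z).
Proof.
move=> fg rf rg; case: z => m; first exact: regularX.
apply: regular_ext (regularX m.+1 rg) => x.
by rewrite fg exprVn.
Qed.

Lemma regular_SL n (f : G -> SL k n) :
  (forall i j, regular_fun (fun x => f x i j)) ->
  forall i, regular_fun (fun x => Defs.coord (f x) i).
Proof.
move=> rf i; case/mxvec_indexP: i => i j; apply: regular_ext (rf i j) => x.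
by rewrite /Defs.coord /= mxvecE.
Qed.

End RegularFunctions.

Section MonomialPairs.
Variables (k : fieldType) (n : nat) (d : 'I_n -> int).
Variables (phi : Ga k -> SL k n) (omega : Gm k -> SL k n).
Variables (c : 'I_n -> 'I_n -> k) (m : 'I_n -> 'I_n -> nat).
Hypothesis phiE : forall (t : k) i j, phi t i j = c i j * t ^+ m i j.
Hypothesis omegaE :
  forall u : Gm k, omega u = diag_mx (\row_i (u : k) ^ d i) :> 'M[k]_n.
Hypothesis weight : forall i j, c i j != 0 -> d i = d j + (2 * m i j)%N%:Z.
Hypothesis phiD : forall s t : k, phi (s + t) = (phi s * phi t)%g.

Lemma monomial_Ga_hom : alg_hom phi.
Proof.
split=> //; apply: regular_SL => i j.
apply: (@regular_ext _ _ (fun t : Ga k => c i j * Defs.coord t 0 ^+ m i j)).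
  by move=> t; rewrite phiE.
by apply: regularM (regular_const _ _) (regularX _ _); apply: regular_coord.
Qed.

Lemma diag_Gm_hom : alg_hom omega.
Proof.
split=> [|u v]; last first.
  apply: val_inj => /=; rewrite !omegaE; apply/matrixP => i j.
  by rewrite mul_diag_mx !mxE mulrnAr expfzMl.
apply: regular_SL => i j.
apply: (@regular_ext _ _ (fun u : Gm k => (i == j)%:R * Defs.coord u 0 ^ d i)).
  move=> u; rewrite omegaE !mxE /Defs.coord /=.
  by case: eqP => [->|_]; rewrite ?mul1r ?mul0r.
apply: regularM (regular_const _ _) _.
by apply: (regular_exprz (g := fun u : Gm k => Defs.coord u 1));
  [|exact: regular_coord..].
Qed.

(** Everything reduces to omega(u) phi(t') = phi(u^2 t') omega(u). In entry (i,j) this compares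
    u^(d_i) with u^(2 m_ij + d_j), which is exactly [weight] wherever the coefficient is nonzero. *)
Lemma monomial_pair_hom : alg_hom (psi_pair phi omega).
Proof.
split; last first.
  move=> [t u] [t' u']; rewrite /psi_pair /=.
  rewrite phiD diag_Gm_hom.2 -!mulgA; congr (_ * _)%g; rewrite !mulgA.
  congr (_ * _)%g; apply: val_inj => /=.
  rewrite !omegaE; apply/matrixP => i j.
  rewrite mul_diag_mx mul_mx_diag !mxE !phiE.
  have [->|/weight ->] := eqVneq (c i j) 0; first by rewrite !mul0r mulr0.
  rewrite expfzDr ?Gm_neq0 // -exprnP exprMn -exprM.
  by rewrite [in RHS]mulrCA; ring.
apply: regular_SL => i j.
apply: (@regular_ext _ _ (fun x : GaGm k =>
  c i j * Defs.coord x 0 ^+ m i j * Defs.coord x 1 ^ d j)).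
  by case=> t u; rewrite /psi_pair /= omegaE mul_mx_diag !mxE phiE.
apply: regularM; first apply: regularM (regular_const _ _) (regularX _ _).
  exact: regular_coord.
by apply: (regular_exprz (g := fun x : GaGm k => Defs.coord x 2));
  [|exact: regular_coord..].
Qed.

End MonomialPairs.

(** * Additive monomials *)

Section PowersOfP.
Variables (p : nat) (p_pr : prime p).

(** Otherwise p^f exceeds p^e1, so e3 is smaller than both e1 and f, and p^(e3+1) would divide p^e3.
    This keeps 2 p^e1 - p^e3 from being a power of p. *)
Lemma expn_addn_neq_double e1 e3 f :
  (e3 < e1)%N -> (p ^ e3 + p ^ f <> (p ^ e1).*2)%N.
Proof.
move=> lt31 eqf; have p_gt1 := prime_gt1 p_pr.
have lt3e : (p ^ e3 < p ^ e1)%N by rewrite ltn_exp2l.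
have lt3f : (e3 < f)%N by rewrite -(ltn_exp2l _ _ p_gt1); lia.
have: (p ^ e3.+1 %| p ^ e3)%N.
  rewrite -(dvdn_addl _ (dvdn_exp2l p lt3f)) eqf -muln2.
  by rewrite dvdn_mulr // dvdn_exp2l.
by rewrite dvdn_Pexp2l // ltnn.
Qed.

End PowersOfP.

Section MonomialIdentities.
Variables (k : closedFieldType) (p : nat) (pchark : p \in [pchar k]).

Lemma frobeniusD (s t : k) e :
  (s + t) ^+ (p ^ e) = s ^+ (p ^ e) + t ^+ (p ^ e).
Proof.
apply: exprDn_pchar; rewrite pnatX ?pnatE ?pchark //.
exact: pcharf_prime pchark.
Qed.

Lemma two_monomials (x y : k) i j :
  i <> j -> (forall s, s != 0 -> x * s ^+ i = y * s ^+ j) -> x = 0 /\ y = 0.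
Proof.
move=> ij e; have: x *: 'X^i - y *: 'X^j = 0 :> {poly k}.
  by apply: poly_ext0 => s s0; rewrite !hornerE (e s) // subrr.
have ijF : (i == j) = false by apply/eqP.
move=> q0; move: (congr1 (fun q : {poly k} => q`_i) q0).
rewrite !coefE eqxx ijF mulr1 mulr0 subr0 => x0.
move: (congr1 (fun q : {poly k} => q`_j) q0).
rewrite !coefE eqxx eq_sym ijF mulr1 mulr0 sub0r => /eqP.
by rewrite oppr_eq0 => /eqP.
Qed.

Lemma closed_root (m : nat) (x : k) : (0 < m)%N -> exists y, y ^+ m = x.
Proof.
(* The coefficient function is x at index 0 and the default 0 elsewhere, so the monic equation
   solved is y^m = x. *)
move=> m_gt0; have [] := @solve_monicpoly k m (nth 0 [:: x]) m_gt0.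
move=> y yE; exists y; rewrite {}yE.
case: m m_gt0 => // m _; rewrite big_ord_recl /= mulr1 big1 ?addr0 // => i _.
by rewrite /= nth_nil mul0r.
Qed.

(** Write m = n p^e with n prime to p. Since the p^e-th power map is additive and surjective, (S +
    1)^n = S^n + 1 holds identically; for n > 1 its derivative at 0 would give n = 0 in [k]. *)
Lemma additive_monomial (c : k) m : c != 0 -> (0 < m)%N ->
  (forall s t, c * (s + t) ^+ m = c * s ^+ m + c * t ^+ m) ->
  exists e, m = (p ^ e)%N.
Proof.
move=> c0 m_gt0 mD; have p_pr := pcharf_prime pchark.
have [n cop_pn mE] := pfactor_coprime p_pr m_gt0.
set e := logn p m in mE; exists e; rewrite {}mE in mD *.
have q_gt0 : (0 < p ^ e)%N by rewrite expn_gt0 prime_gt0.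
have [n1|n1] := eqVneq n 1%N; first by rewrite n1 mul1n.
have q0 : ('X + 1) ^+ n - 'X^n - 1 = 0 :> {poly k}.
  apply: poly_ext0 => S _; have [s <-] := closed_root S q_gt0.
  rewrite !hornerE. rewrite -{1}[1](expr1n _ (p ^ e)) -frobeniusD -!exprM mulnC.
  move: (mD s 1); rewrite -mulrDr => /(mulfI c0) ->.
  by rewrite expr1n addrAC addrK subrr.
have nk0 : n%:R != 0 :> k by rewrite -(dvdn_pcharf pchark) -prime_coprime.
have n_gt1 : (1 < n)%N.
  by case: n n1 nk0 {cop_pn mD q0} => [|[|]] //; rewrite eqxx.
have := congr1 (fun q : {poly k} => q^`().[0]) q0.
rewrite !derivE deriv_exp !derivE !(hornerE, hornerMn). rewrite expr1n expr0n.
by case: n n_gt1 nk0 {cop_pn mD n1 q0} => [|[|n]] //= _ /negPf nk0 /eqP;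
  rewrite ?mul0rn ?subr0 // ?oppr0 ?add0r ?expr1n ?nk0.
Qed.

(** Comparing F(s,1) with F(1,s) gives (x - y) s^i = (x - y) s^j, and the two monomials are
    independent. *)
Lemma symmetric_monomials (F : k -> k -> k) (x y : k) i j :
  i <> j -> (forall s t, F s t = F t s) ->
  (forall s t, F s t = x * (s ^+ i * t ^+ j) + y * (s ^+ j * t ^+ i)) -> x = y.
Proof.
move=> ij Fsym FE; apply/eqP; rewrite -subr_eq0; apply/eqP.
have [s s0|//] := @two_monomials (x - y) (x - y) i j ij.
have := Fsym s 1; rewrite !FE !expr1n !mulr1 !mul1r => /eqP.
rewrite -subr_eq0 => /eqP e; apply/eqP; rewrite -subr_eq0 -e.
by apply/eqP; ring.
Qed.

End MonomialIdentities.

(** * Additivity of the listed forms *)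

(* The weights (d1, d2, - d2, - d1) of the torus make the entries (1,2) and
   (3,4), and likewise (1,3) and (2,4), scale by the same power. *)
Definition monomial4 (k : fieldType) (c12 c13 c14 c23 c24 c34 : k)
    (a b m n : nat) (t : k) : 'M[k]_4 :=
  upper4 (c12 * t ^+ a) (c13 * t ^+ b) (c14 * t ^+ m)
    (c23 * t ^+ n) (c24 * t ^+ b) (c34 * t ^+ a).

(** Each weight equation is required only when a coefficient using that exponent is nonzero, so
    vanishing entries may carry a dummy exponent. *)
Definition additive_weights (k : fieldType) (d1 d2 : int)
    (c12 c13 c14 c23 c24 c34 : k) (a b m n : nat) (M : k -> 'M[k]_4) :=
  [/\ forall t, M t = monomial4 c12 c13 c14 c23 c24 c34 a b m n t,
      forall s t, M (s + t) = M s *m M t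
    & [/\ c12 = 0 /\ c34 = 0 \/ d1 = d2 + a.*2%:Z,
          c13 = 0 /\ c24 = 0 \/ d1 + d2 = b.*2%:Z,
          c14 = 0 \/ d1 = m%:Z & c23 = 0 \/ d2 = n%:Z]].

Section Forms.
Variables (k : closedFieldType) (p : nat) (pchark : p \in [pchar k]).

(** Gives d2 = p^f - 2 p^e >= 0 in forms such as V, and leaves no power of p strictly between p^e
    and 2 p^e. *)
Lemma expn_double_le e f : (e < f)%N -> ((p ^ e).*2 <= p ^ f)%N.
Proof.
move=> lt; have p_gt1 := prime_gt1 (pcharf_prime pchark).
rewrite -mul2n (leq_trans (leq_mul p_gt1 (leqnn _))) //.
by rewrite -expnS leq_exp2l.
Qed.

Lemma natr_neq0_pchar n : (0 < n < p)%N -> n%:R != 0 :> k.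
Proof.
by move=> /andP[n0 np]; rewrite -(dvdn_pcharf pchark) gtnNdvd.
Qed.

Lemma neq2_pchar : (2 < p)%N -> 2 != 0 :> k.
Proof. by move=> p2; rewrite natr_neq0_pchar. Qed.

Lemma neq6_pchar : (4 < p)%N -> 6 != 0 :> k.
Proof.
move=> p4; rewrite (natrM k 2 3) mulf_neq0 // natr_neq0_pchar //=; lia.
Qed.

Let exprM2 (x : k) q : x ^+ (2 * q) = (x ^+ q) ^+ 2.
Proof. by rewrite mulnC exprM. Qed.
Let exprM3 (x : k) q : x ^+ (3 * q) = (x ^+ q) ^+ 3.
Proof. by rewrite mulnC exprM. Qed.

Ltac arith :=
  repeat match goal with
  | H : is_true (?e < ?f)%N |- _ => move: (expn_double_le H); clear H
  end; lia.

(** For additivity, [frobeniusD] splits the p-powers of s + t; the p-powers of s and t are then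
    generalized to variables, which leaves a rational identity for [field] with 2 and 6 invertible
    where they occur. *)
Ltac monomial_form ME c12 c13 c14 c23 c24 c34 a b m n :=
  split; first arith; exists c12, c13, c14, c23, c24, c34, a, b, m, n; split;
  [ move=> t; rewrite ME -?addrA ?form_upper4 ?upper4_1 /monomial4;
    by rewrite ?(mulr0, mul0r, mulr1, mul1r, addr0, add0r)
  | move=> s t; rewrite !ME -?addrA ?form_upper4 ?upper4_1 mul_upper4;
    rewrite ?exprM2 ?exprM3 ?exprD ?frobeniusD //;
    repeat match goal with |- context [?x ^+ (p ^ ?e)] =>
      let y := fresh "y" in set y := x ^+ (p ^ e); move: @y => y end;
    rewrite ?(mulr0, mul0r, mulr1, mul1r, addr0, add0r);
    by congr upper4; field; do ?[apply/andP; split]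
  | split; solve [left; by [] | right; arith] ].

Lemma form_cond_monomial4 nu (d1 d2 : int) (M : k -> 'M[k]_4) :
  form_cond p nu d1 d2 M ->
  0 <= d2 <= d1 /\ exists c12 c13 c14 c23 c24 c34 a b m n,
    additive_weights d1 d2 c12 c13 c14 c23 c24 c34 a b m n M.
Proof.
have pX e : p%:Z ^+ e = (p ^ e)%N%:Z by rewrite -[in RHS]natz natrX natz.
have p_gt1 := prime_gt1 (pcharf_prime pchark).
have pgt0 e : (0 < p ^ e)%N by rewrite expn_gt0 ltnW.
have k2 : (2 < p)%N -> 2 != 0 :> k by exact: neq2_pchar.
case: nu; rewrite /= ?pX.
- case=> p5 [e] [d1E d2E ME]; rewrite ?pX in d1E d2E.
  have := pgt0 e.
  have {}k2 : 2 != 0 :> k by apply: k2; lia.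
  have k6 := neq6_pchar p5.
  by monomial_form ME (1 : k) (2^-1 : k) (6^-1 : k) (1 : k) (2^-1 : k) (1 : k)
    (p ^ e)%N (2 * p ^ e)%N (3 * p ^ e)%N (p ^ e)%N.
- case=> p3 [e] [d1E d2E ME]; rewrite ?pX in d1E d2E.
  have := pgt0 e.
  have {}k2 : 2 != 0 :> k by apply: k2; lia.
  (* Only for p = 3 does the additive exponent p^(e+1) of entry (1,4) agree with the weight d1 = d2
     + 2 p^e imposed by entry (1,2). *)
  have eS : (p ^ e.+1 = 3 * p ^ e)%N by rewrite expnS p3.
  by monomial_form ME (1 : k) (2^-1 : k) (1 : k) (1 : k) (0 : k) (0 : k)
    (p ^ e)%N (2 * p ^ e)%N (p ^ e.+1)%N (p ^ e)%N.
- case=> p3 [e] [d1E d2E ME]; rewrite ?pX in d1E d2E.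
  have := pgt0 e.
  have {}k2 : 2 != 0 :> k by apply: k2; lia.
  by monomial_form ME (1 : k) (2^-1 : k) (0 : k) (1 : k) (0 : k) (0 : k)
    (p ^ e)%N (2 * p ^ e)%N 0%N (p ^ e)%N.
- case=> e1 [e2] [lt d1E d2E ME]; rewrite ?pX in d1E d2E.
  have := pgt0 e1. have := pgt0 e2.
  by monomial_form ME (1 : k) (1 : k) (1 : k) (0 : k) (1 : k) (1 : k)
    (p ^ e1)%N (p ^ e2)%N (p ^ e1 + p ^ e2)%N 0%N.
- case=> e1 [e2] [lt d1E d2E ME]; rewrite ?pX in d1E d2E.
  have := pgt0 e1. have := pgt0 e2.
  by monomial_form ME (1 : k) (0 : k) (1 : k) (0 : k) (0 : k) (1 : k)
    (p ^ e1)%N 0%N (p ^ e2)%N 0%N.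
- case=> e1 [d1E d2E ME]; rewrite ?pX in d1E d2E.
  have := pgt0 e1.
  by monomial_form ME (1 : k) (0 : k) (0 : k) (0 : k) (0 : k) (1 : k)
    (p ^ e1)%N 0%N 0%N 0%N.
- case=> p3 [e] [d1E d2E ME]; rewrite ?pX in d1E d2E.
  have := pgt0 e.
  have {}k2 : 2 != 0 :> k by apply: k2; lia.
  have eS : (p ^ e.+1 = 3 * p ^ e)%N by rewrite expnS p3.
  by monomial_form ME (0 : k) (0 : k) (1 : k) (1 : k) (2^-1 : k) (1 : k)
    (p ^ e)%N (2 * p ^ e)%N (p ^ e.+1)%N (p ^ e)%N.
- case=> p3 [e] [d1E d2E ME]; rewrite ?pX in d1E d2E.
  have := pgt0 e.
  have {}k2 : 2 != 0 :> k by apply: k2; lia.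
  by monomial_form ME (0 : k) (0 : k) (0 : k) (1 : k) (2^-1 : k) (1 : k)
    (p ^ e)%N (2 * p ^ e)%N 0%N (p ^ e)%N.
- case=> p3 [e] [d1E d2E ME]; rewrite ?pX in d1E d2E.
  have := pgt0 e.
  have {}k2 : 2 != 0 :> k by apply: k2; lia.
  by monomial_form ME (1 : k) (0 : k) (2^-1 : k) (0 : k) (1 : k) (0 : k)
    (p ^ e)%N (p ^ e)%N (2 * p ^ e)%N 0%N.
- case=> e1 [e2] [lt d1E d2E ME]; rewrite ?pX in d1E d2E.
  have := pgt0 e1. have := pgt0 e2.
  by monomial_form ME (1 : k) (1 : k) (0 : k) (0 : k) (0 : k) (0 : k)
    (p ^ e1)%N (p ^ e2)%N 0%N 0%N.
- case=> e1 [e2] [lt d1E d2E ME]; rewrite ?pX in d1E d2E.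
  have := pgt0 e1. have := pgt0 e2.
  by monomial_form ME (1 : k) (0 : k) (1 : k) (0 : k) (0 : k) (0 : k)
    (p ^ e1)%N 0%N (p ^ e2)%N 0%N.
- case=> e1 [d1E d2E ME]; rewrite ?pX in d1E d2E.
  have := pgt0 e1.
  by monomial_form ME (1 : k) (0 : k) (0 : k) (0 : k) (0 : k) (0 : k)
    (p ^ e1)%N 0%N 0%N 0%N.
- case=> e1 [e2] [lt d1E d2E ME]; rewrite ?pX in d1E d2E.
  have := pgt0 e1. have := pgt0 e2.
  by monomial_form ME (0 : k) (1 : k) (0 : k) (1 : k) (1 : k) (0 : k)
    0%N (p ^ e1)%N 0%N (p ^ e2)%N.
- case=> e1 [e2] [lt d1E d2E ME]; rewrite ?pX in d1E d2E.
  have := pgt0 e1. have := pgt0 e2.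
  by monomial_form ME (0 : k) (1 : k) (0 : k) (1 : k) (0 : k) (0 : k)
    0%N (p ^ e1)%N 0%N (p ^ e2)%N.
- case=> e1 [e2] [le d1E d2E ME]; rewrite ?pX in d1E d2E.
  have := pgt0 e1. have := pgt0 e2.
  have := leq_pexp2l (ltnW p_gt1) le.
  by monomial_form ME (0 : k) (0 : k) (1 : k) (1 : k) (0 : k) (0 : k)
    0%N 0%N (p ^ e1)%N (p ^ e2)%N.
- case=> e1 [e2] [lt d1E d2E ME]; rewrite ?pX in d1E d2E.
  have := pgt0 e1. have := pgt0 e2.
  by monomial_form ME (0 : k) (0 : k) (0 : k) (1 : k) (1 : k) (0 : k)
    0%N (p ^ e2)%N 0%N (p ^ e1)%N.
- case=> e1 [d1E d2E ME]; rewrite ?pX in d1E d2E.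
  have := pgt0 e1.
  by monomial_form ME (0 : k) (0 : k) (0 : k) (1 : k) (0 : k) (0 : k)
    0%N 0%N 0%N (p ^ e1)%N.
- case=> e1 [e2] [lt d1E d2E ME]; rewrite ?pX in d1E d2E.
  have := pgt0 e1. have := pgt0 e2.
  by monomial_form ME (0 : k) (0 : k) (0 : k) (0 : k) (1 : k) (1 : k)
    (p ^ e1)%N (p ^ e2)%N 0%N 0%N.
- case=> e1 [e2] [lt d1E d2E ME]; rewrite ?pX in d1E d2E.
  have := pgt0 e1. have := pgt0 e2.
  by monomial_form ME (0 : k) (0 : k) (1 : k) (0 : k) (0 : k) (1 : k)
    (p ^ e1)%N 0%N (p ^ e2)%N 0%N.
- case=> e1 [d1E d2E ME]; rewrite ?pX in d1E d2E.
  have := pgt0 e1.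
  by monomial_form ME (0 : k) (0 : k) (0 : k) (0 : k) (0 : k) (1 : k)
    (p ^ e1)%N 0%N 0%N 0%N.
- case=> p2 [e] [d1E d2E ME]; rewrite ?pX in d1E d2E.
  have := pgt0 e.
  have eS : (p ^ e.+1 = 2 * p ^ e)%N by rewrite expnS p2.
  by monomial_form ME (0 : k) (1 : k) (1 : k) (0 : k) (1 : k) (0 : k)
    0%N (p ^ e)%N (p ^ e.+1)%N 0%N.
- case=> e1 [d1E d2E ME]; rewrite ?pX in d1E d2E.
  have := pgt0 e1.
  by monomial_form ME (0 : k) (1 : k) (0 : k) (0 : k) (1 : k) (0 : k)
    0%N (p ^ e1)%N 0%N 0%N.
- case=> e1 [d1E d2E ME]; rewrite ?pX in d1E d2E.
  have := pgt0 e1.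
  by monomial_form ME (0 : k) (1 : k) (0 : k) (0 : k) (0 : k) (0 : k)
    0%N (p ^ e1)%N 0%N 0%N.
- case=> e1 [d1E d2E ME]; rewrite ?pX in d1E d2E.
  have := pgt0 e1.
  by monomial_form ME (0 : k) (0 : k) (1 : k) (0 : k) (0 : k) (0 : k)
    0%N 0%N (p ^ e1)%N 0%N.
- case=> e1 [d1E d2E ME]; rewrite ?pX in d1E d2E.
  have := pgt0 e1.
  by monomial_form ME (0 : k) (0 : k) (0 : k) (0 : k) (1 : k) (0 : k)
    0%N (p ^ e1)%N 0%N 0%N.
- move=> [d12 ME].
  by monomial_form ME (0 : k) (0 : k) (0 : k) (0 : k) (0 : k) (0 : k)
    0%N 0%N 0%N 0%N.
Qed.
End Forms.

(** * Weights of the torus and the first assertion *)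

Section Diag4.
Variable k : fieldType.

Definition weight4 (d1 d2 : int) (i : 'I_4) : int :=
  nth 0 [:: d1; d2; - d2; - d1] i.

Lemma diag4E (d1 d2 : int) (u : k) :
  diag4 d1 d2 u = diag_mx (\row_i u ^ weight4 d1 d2 i).
Proof.
by congr diag_mx; apply/rowP => -[[|[|[|[|//]]]] ?]; rewrite !mxE.
Qed.

Lemma in_Omega_diag4 (d1 d2 : int) (omega : Gm k -> SL k 4) :
  0 <= d2 <= d1 -> (forall u, omega u = diag4 d1 d2 u :> 'M_4) ->
  in_Omega omega.
Proof.
move=> /andP[d2_ge0 d21] omE; have omE' u := etrans (omE u) (diag4E d1 d2 u).
split; first exact: diag_Gm_hom omE'.
exists (weight4 d1 d2); split=> //.
  by case=> -[|[|[|[|//]]]] ? [[|[|[|[|//]]]] ?] //= _;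
    rewrite /weight4 /=; lia.
by case=> -[|[|[|[|//]]]] ?; rewrite /weight4 /= ?opprK.
Qed.

(** Antisymmetry recovers the last two weights from the first two, and the inequality between the
    middle weights becomes -d2 <= d2, whence 0 <= d2. *)
Lemma in_Omega4P (omega : Gm k -> SL k 4) : in_Omega omega ->
  exists d1 d2 : int,
    0 <= d2 <= d1 /\ forall u, omega u = diag4 d1 d2 u :> 'M_4.
Proof.
move=> [_ [d [d_le dN omE]]].
have d2E := dN (inord 2); have d3E := dN (inord 3).
have r2 : rev_ord (inord 2) = inord 1 :> 'I_4.
  by apply: val_inj; rewrite /= !inordK.
have r3 : rev_ord (inord 3) = inord 0 :> 'I_4.
  by apply: val_inj; rewrite /= !inordK.
rewrite {}r2 in d2E; rewrite {}r3 in d3E.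
have le01 := d_le (inord 0) (inord 1); have le12 := d_le (inord 1) (inord 2).
rewrite !inordK // in le01 le12; rewrite d2E in le12.
exists (d (inord 0)), (d (inord 1)); split.
  by rewrite le01 // andbT; have := le12 isT; lia.
move=> u; rewrite omE; congr diag_mx; apply/rowP => i; rewrite !mxE -d2E -d3E.
by case: i => -[|[|[|[|//]]]] lt /=;
  congr (_ ^ d _); apply: val_inj; rewrite /= inordK.
Qed.

Variables (d1 d2 : int) (c12 c13 c14 c23 c24 c34 : k) (a b m n : nat).
Variables (phi : Ga k -> SL k 4) (omega : Gm k -> SL k 4).
Hypothesis phiP : additive_weights d1 d2 c12 c13 c14 c23 c24 c34 a b m n
  (fun t : k => phi t : 'M[k]_4).
Hypothesis omegaE : forall u : Gm k, omega u = diag4 d1 d2 u :> 'M_4.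

Lemma family_pair_hom : alg_hom phi /\ alg_hom (psi_pair phi omega).
Proof.
case: phiP => phiE phiD [w12 w13 w14 w23].
pose c (i j : 'I_4) := upper4 c12 c13 c14 c23 c24 c34 i j.
pose e (i j : 'I_4) := nth 0%N (nth [::] [:: [:: 0; a; b; m]; [:: 0; 0; n; b];
  [:: 0; 0; 0; a]; [:: 0; 0; 0; 0]]%N i) j.
have phi_mono (t : k) i j : phi t i j = c i j * t ^+ e i j.
  rewrite phiE /c /e /monomial4 /upper4 /mx4 !mxE.
  by case: i j => -[|[|[|[|//]]]] ? [[|[|[|[|//]]]] ?] //=;
    rewrite ?mul0r ?mulr1.
have phi_mul (s t : k) : phi (s + t) = (phi s * phi t)%g.
  by apply: val_inj; apply: phiD.
split; first exact: monomial_Ga_hom phi_mono phi_mul.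
apply: (monomial_pair_hom phi_mono (d := weight4 d1 d2)) => //.
  by move=> u; rewrite omegaE diag4E.
move=> i j; rewrite /c /upper4 /mx4 !mxE /weight4 /e.
case: i j => -[|[|[|[|//]]]] ? [[|[|[|[|//]]]] ?] //= nz;
  rewrite ?eqxx // in nz *; first [ lia
  | case: w12 => [[z12 z34]|]; [by rewrite ?z12 ?z34 eqxx in nz | lia]
  | case: w13 => [[z13 z24]|]; [by rewrite ?z13 ?z24 eqxx in nz | lia]
  | case: w14 => [z14|]; [by rewrite ?z14 eqxx in nz | lia]
  | case: w23 => [z23|]; [by rewrite ?z23 eqxx in nz | lia]].
Qed.

End Diag4.

(** Beyond the first assertion, this spares the classification any check of membership: a pair
    brought to a listed form is automatically in the required sets. *)
Lemma has_form_hom (k : closedFieldType) p (pchark : p \in [pchar k]) nu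
    (phi : Ga k -> SL k 4) (omega : Gm k -> SL k 4) :
  has_form p nu phi omega ->
  [/\ in_U phi, in_Omega omega & alg_hom (psi_pair phi omega)].
Proof.
move=> [d1 [d2 [omE /(form_cond_monomial4 pchark)[d12 fam]]]].
have [c12 [c13 [c14 [c23 [c24 [c34 [a [b [m [n phiP]]]]]]]]]] := fam.
have [phi_hom psi_hom] := family_pair_hom phiP omE.
split=> //; last exact: in_Omega_diag4 d12 omE.
split=> // t; have [phiE _ _] := phiP.
split=> [i|i j]; rewrite phiE /monomial4 /upper4 /mx4 mxE.
  by case: i => -[|[|[|[|//]]]].
by case: i j => -[|[|[|[|//]]]] ? [[|[|[|[|//]]]] ?].
Qed.

(** The hypothesis says that q(X^2) = q(1) X^D. Comparing degrees makes D even unless q(1) = 0, and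
    every element of [k] is a square, so q is known everywhere. For odd D the truncated half is
    harmless, because q is then 0. *)
Lemma weighted_poly_monomial (k : closedFieldType) (q : {poly k}) D :
  (forall u, u != 0 -> q.[u ^+ 2] = u ^+ D * q.[1]) ->
  q = q.[1] *: 'X^(D./2) /\ (q.[1] != 0 -> D = D./2.*2).
Proof.
move=> qD; set c := q.[1].
have qcomp : q \Po 'X^2 = c *: 'X^D.
  apply/eqP; rewrite -subr_eq0; apply/eqP; apply: poly_ext0 => u u0.
  by rewrite !hornerE horner_comp hornerXn qD // mulrC subrr.
have [c0|c0] := eqVneq c 0.
  split=> //; rewrite c0 scale0r; apply: poly_ext0 => x x0.
  have [u ux] := @closed_root k 2 x isT.
  rewrite -ux qD -/c ?c0 ?mulr0 //.
  by apply: contraNneq x0 => u0; rewrite -ux u0 expr0n.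
have DE : D = (size q).-1.*2.
  have := congr1 (fun r : {poly k} => (size r).-1) qcomp.
  rewrite size_scale // size_polyXn /= => <-.
  by rewrite size_comp_poly size_polyXn muln2.
split; last by rewrite DE doubleK.
apply/eqP; rewrite -subr_eq0; apply/eqP; apply: poly_ext0 => x x0.
have [u ux] := @closed_root k 2 x isT.
have u0 : u != 0 by apply: contraNneq x0 => u0; rewrite -ux u0 expr0n.
rewrite !hornerE -ux qD // -exprM mul2n {2}DE doubleK -DE.
by rewrite -/c mulrC subrr.
Qed.

(** * Monomial entries forced by the torus *)

Section HomToMonomials.
Variables (k : closedFieldType) (n : nat) (d : 'I_n -> int).
Variables (phi : Ga k -> SL k n) (omega : Gm k -> SL k n).
Hypothesis phi_hom : alg_hom phi.
Hypothesis omegaE :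
  forall u : Gm k, omega u = diag_mx (\row_i Gm_val u ^ d i) :> 'M[k]_n.
Hypothesis psiM : {morph psi_pair phi omega : x y / (x * y)%g}.

Lemma hom_at0 : phi 0 = 1%g.
Proof.
have e : phi 0 = (phi 0 * phi 0)%g by rewrite -phi_hom.2 [(_ * _)%g]addr0.
by apply: (mulgI (phi 0)); rewrite mulg1 -e.
Qed.

(** Apply multiplicativity to (0,u)(t,1) = (u^2 t, u) and compare entries. *)
Lemma pair_hom_weight (u : Gm k) (t : k) i j :
  phi (Gm_val u ^+ 2 * t) i j * Gm_val u ^ d j = Gm_val u ^ d i * phi t i j.
Proof.
have omega1 : omega (Gm_one k) = 1%g.
  apply: val_inj; rewrite /= omegaE; apply/matrixP => i' j'.
  by rewrite !mxE /= exp1rz.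
have := psiM (MkGaGm (0 : k) u) (MkGaGm t (Gm_one k)).
have -> : (MkGaGm (0 : k) u * MkGaGm t (Gm_one k))%g =
    MkGaGm (Gm_val u ^+ 2 * t) u.
  by congr MkGaGm; [rewrite add0r | apply: mulg1].
rewrite /psi_pair /= hom_at0 omega1 mul1g mulg1.
move/(congr1 (fun A : SL k n => (A : 'M_n) i j)).
by rewrite /= omegaE mul_diag_mx mul_mx_diag !mxE.
Qed.

(** Take t = 1 in the weight relation. The exponent of a nonzero entry is positive because phi(0) =
    1 has no off-diagonal constant. *)
Lemma pair_hom_monomial i j : i != j -> d j <= d i ->
  exists c : k, (forall t, phi t i j = c * t ^+ `|d i - d j|./2) /\
    (c != 0 -> (0 < `|d i - d j|./2)%N /\
      d i = d j + (`|d i - d j|./2.*2)%N%:Z).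
Proof.
move=> ij d_le; have [q qP] := regular_Ga (phi_hom.1 (mxvec_index i j)).
have {}qP (t : k) : phi t i j = q.[t] by rewrite -qP /Defs.coord /= mxvecE.
set D := `|d i - d j|%N.
have dE : d i = d j + D%:Z by rewrite gez0_abs ?subr_ge0 // addrCA subrr addr0.
have qD u : u != 0 -> q.[u ^+ 2] = u ^+ D * q.[1].
  move=> u0; have := pair_hom_weight (MkGm u0) 1 i j.
  rewrite /= mulr1 !qP dE expfzDr // -mulrA mulrC => /mulfI -> //.
  by rewrite expfz_neq0.
have [qE Deven] := weighted_poly_monomial qD.
exists q.[1]; split=> [t|c0]; first by rewrite qP {1}qE !hornerE.
rewrite -Deven // lt0n; split=> //; apply: contraNneq c0 => D0.
have := qP 0; rewrite hom_at0 mxE (negPf ij) qE D0 => /esym.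
by rewrite !hornerE => /eqP; rewrite qE D0 !hornerE.
Qed.

End HomToMonomials.

(** * Conjugation by the centralizer of the torus *)

Section Conjugation.
Variables (k : fieldType) (p : nat).

(** [P] commutes with the torus, so the same weights serve before and after conjugation. [M'] is
    only matrix-valued; that it lands in SL(4) is recovered from [P] being invertible. *)
Definition normalizable (m n : nat) (M : k -> 'M[k]_4) : Prop :=
  exists P M' nu,
    [/\ P \in unitmx,
        forall u, u != 0 -> diag4 m n u *m P = P *m diag4 m n u,
        forall t, M t *m P = P *m M' t
      & form_cond p nu m n M'].

Definition additive_mx (M : k -> 'M[k]_4) : Prop :=
  forall s t, M (s + t) = M s *m M t.

(** Lets conjugations be chained: the conjugate is again additive, so its coefficient relations are
    available to the next step. *)
Lemma normalizable_conj (m n : nat) (P : 'M[k]_4) (M M' : k -> 'M[k]_4) :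
  P \in unitmx -> (forall u, u != 0 -> diag4 m n u *m P = P *m diag4 m n u) ->
  (forall t, M t *m P = P *m M' t) ->
  additive_mx M -> (additive_mx M' -> normalizable m n M') ->
  normalizable m n M.
Proof.
move=> uP dP MP Madd; case=> [s t|].
  apply: (can_inj (mulKmx uP)).
  by rewrite -MP Madd -mulmxA MP mulmxA MP mulmxA.
move=> Q [M'' [nu [uQ dQ MQ form]]].
exists (P *m Q), M'', nu; split=> // [|u u0|t].
- by rewrite unitmx_mul uP.
- by rewrite mulmxA dP // -!mulmxA dQ.
- by rewrite mulmxA MP -!mulmxA MQ.
Qed.

Lemma diag4_mx4 (d1 d2 : int) (u : k) : diag4 d1 d2 u =
  mx4 (u ^ d1) 0 0 0 0 (u ^ d2) 0 0 0 0 (u ^ (- d2)) 0 0 0 0 (u ^ (- d1)).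
Proof.
by apply/matrixP => -[[|[|[|[|//]]]] ?] [[|[|[|[|//]]]] ?]; rewrite !mxE.
Qed.

Variables (c12 c13 c14 c23 c24 c34 : k).

(** Conjugation by diag(x1, x2, x3, x4) multiplies the coefficient in position (i,j) by x_j / x_i;
    the equations are stated without division. *)
Lemma normalizable_scale nu x1 x2 x3 x4 y12 y13 y14 y23 y24 y34
    (a b m n : nat) :
  x1 != 0 -> x2 != 0 -> x3 != 0 -> x4 != 0 ->
  c12 * x2 = x1 * y12 -> c13 * x3 = x1 * y13 -> c14 * x4 = x1 * y14 ->
  c23 * x3 = x2 * y23 -> c24 * x4 = x2 * y24 -> c34 * x4 = x3 * y34 ->
  form_cond p nu m n (monomial4 y12 y13 y14 y23 y24 y34 a b m n) ->
  normalizable m n (monomial4 c12 c13 c14 c23 c24 c34 a b m n).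
Proof.
move=> x1n0 x2n0 x3n0 x4n0 e12 e13 e14 e23 e24 e34 form.
exists (mx4 x1 0 0 0 0 x2 0 0 0 0 x3 0 0 0 0 x4).
exists (monomial4 y12 y13 y14 y23 y24 y34 a b m n), nu; split=> // [|u _|t].
- have PV : mx4 x1 0 0 0 0 x2 0 0 0 0 x3 0 0 0 0 x4 *m
      mx4 x1^-1 0 0 0 0 x2^-1 0 0 0 0 x3^-1 0 0 0 0 x4^-1 = 1%:M.
    by rewrite upper4_1 mul_mx4; congr mx4; field.
  by case: (mulmx1_unit PV).
- by rewrite diag4_mx4 !mul_mx4; congr mx4; ring.
rewrite /monomial4 !mul_mx4; move: (t ^+ a) (t ^+ b) (t ^+ m) (t ^+ n).
move=> ta tb tm tn; congr mx4;
  rewrite ?(mul0r, mulr0, addr0, add0r, mul1r, mulr1) //.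
- by rewrite mulrAC e12 mulrA.
- by rewrite mulrAC e13 mulrA.
- by rewrite mulrAC e14 mulrA.
- by rewrite mulrAC e23 mulrA.
- by rewrite mulrAC e24 mulrA.
by rewrite mulrAC e34 mulrA.
Qed.

(* For n = 0 the two middle weights vanish, so that the centralizer of the
   torus contains GL_2 acting on the two middle basis vectors. *)
Lemma normalizable_middle q22 q23 q32 q33 y12 y13 y24 y34 (a m : nat) :
  q22 * q33 - q23 * q32 != 0 ->
  c12 * q22 + c13 * q32 = y12 -> c12 * q23 + c13 * q33 = y13 ->
  c24 = q22 * y24 + q23 * y34 -> c34 = q32 * y24 + q33 * y34 ->
  additive_mx (monomial4 c12 c13 c14 0 c24 c34 a a m 0) ->
  (additive_mx (monomial4 y12 y13 c14 0 y24 y34 a a m 0) ->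
   normalizable m 0 (monomial4 y12 y13 c14 0 y24 y34 a a m 0)) ->
  normalizable m 0 (monomial4 c12 c13 c14 0 c24 c34 a a m 0).
Proof.
move=> D0 e12 e13 e24 e34.
apply: (@normalizable_conj _ _ (mx4 1 0 0 0 0 q22 q23 0 0 q32 q33 0 0 0 0 1)).
- have PV : mx4 1 0 0 0 0 q22 q23 0 0 q32 q33 0 0 0 0 1 *m
      mx4 1 0 0 0 0 (q33 / (q22 * q33 - q23 * q32))
       (- q23 / (q22 * q33 - q23 * q32)) 0 0 (- q32 / (q22 * q33 - q23 * q32))
       (q22 / (q22 * q33 - q23 * q32)) 0 0 0 0 1 = 1%:M.
    by rewrite upper4_1 mul_mx4; congr mx4; field.
  by case: (mulmx1_unit PV).
- move=> u _; rewrite diag4_mx4 oppr0 !expr0z !mul_mx4; congr mx4; ring.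
move=> t; rewrite /monomial4 !mul_mx4 -e12 -e13 e24 e34.
by move: (t ^+ a) (t ^+ m) (t ^+ 0) => ta tm tn; congr mx4; ring.
Qed.

(* For m = n the centralizer of the torus contains GL_2 x GL_2. *)
Lemma normalizable_block q11 q12 q21 q22 r11 r12 r21 r22 y13 y14 y23 y24
    (m : nat) :
  q11 * q22 - q12 * q21 != 0 -> r11 * r22 - r12 * r21 != 0 ->
  c13 * r11 + c14 * r21 = q11 * y13 + q12 * y23 ->
  c13 * r12 + c14 * r22 = q11 * y14 + q12 * y24 ->
  c23 * r11 + c24 * r21 = q21 * y13 + q22 * y23 ->
  c23 * r12 + c24 * r22 = q21 * y14 + q22 * y24 ->
  additive_mx (monomial4 0 c13 c14 c23 c24 0 0 m m m) ->
  (additive_mx (monomial4 0 y13 y14 y23 y24 0 0 m m m) ->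
   normalizable m m (monomial4 0 y13 y14 y23 y24 0 0 m m m)) ->
  normalizable m m (monomial4 0 c13 c14 c23 c24 0 0 m m m).
Proof.
move=> D0 D1 e13 e14 e23 e24.
apply: (@normalizable_conj _ _
  (mx4 q11 q12 0 0 q21 q22 0 0 0 0 r11 r12 0 0 r21 r22)).
- have PV : mx4 q11 q12 0 0 q21 q22 0 0 0 0 r11 r12 0 0 r21 r22 *m
      mx4 (q22 / (q11 * q22 - q12 * q21)) (- q12 / (q11 * q22 - q12 * q21)) 0 0
       (- q21 / (q11 * q22 - q12 * q21)) (q11 / (q11 * q22 - q12 * q21)) 0 0
       0 0 (r22 / (r11 * r22 - r12 * r21)) (- r12 / (r11 * r22 - r12 * r21))
       0 0 (- r21 / (r11 * r22 - r12 * r21)) (r11 / (r11 * r22 - r12 * r21))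
       = 1%:M.
    by rewrite upper4_1 mul_mx4; congr mx4; field; rewrite ?D0 ?D1.
  by case: (mulmx1_unit PV).
- by move=> u _; rewrite diag4_mx4 !mul_mx4; congr mx4; ring.
move=> t; rewrite /monomial4 !mul_mx4.
move: (t ^+ 0) (t ^+ m) => t0 tm; congr mx4;
  rewrite ?(mul0r, mulr0, addr0, add0r, mul1r, mulr1) //.
- by rewrite !(mulrAC _ tm) -mulrDl e13; ring.
- by rewrite !(mulrAC _ tm) -mulrDl e14; ring.
- by rewrite !(mulrAC _ tm) -mulrDl e23; ring.
by rewrite !(mulrAC _ tm) -mulrDl e24; ring.
Qed.

End Conjugation.

(** * Normal forms *)

Section Classification.
Variables (k : closedFieldType) (p : nat) (pchark : p \in [pchar k]).

Definition ppower (a : nat) := exists e, a = (p ^ e)%N.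

Let p_pr : prime p := pcharf_prime pchark.

Let pX e : p%:Z ^+ e = (p ^ e)%N%:Z.
Proof. by rewrite -[in RHS]natz natrX natz. Qed.

(** The first four values are the diagonal of the conjugating matrix, found by solving c_ij x_j =
    x_i y_ij; the last six are the target coefficients y_ij. *)
Ltac scale nu x1 x2 x3 x4 y12 y13 y14 y23 y24 y34 :=
  apply: (@normalizable_scale _ _ _ _ _ _ _ _ nu x1 x2 x3 x4
    y12 y13 y14 y23 y24 y34);
  first [ solve [by rewrite ?mulf_neq0 ?invr_eq0 ?oner_eq0]
        | solve [by field; do ?[apply/andP; split]]
        | rewrite /= ?pX ].

Ltac formeq := move=> t; rewrite -?addrA ?form_upper4 ?upper4_1 /monomial4;
  by rewrite ?(mulr0, mul0r, mulr1, mul1r, addr0, add0r).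

Lemma expn_p_lt e f : (p ^ e < p ^ f)%N = (e < f)%N.
Proof. by rewrite ltn_exp2l // prime_gt1. Qed.

Lemma expn_p_le e f : (p ^ e <= p ^ f)%N = (e <= f)%N.
Proof. by rewrite leq_exp2l // prime_gt1. Qed.

(** The ratios x1 / x4 and x2 / x3 are independent, so both coefficients scale to 1. As [a] and [b]
    are arbitrary, this also covers weights with m - n odd. *)
Lemma normalizable_14_23 (c14 c23 : k) (a b m n : nat) : (n <= m)%N ->
  (c14 != 0 -> ppower m) -> (c23 != 0 -> ppower n) ->
  normalizable p m n (monomial4 0 0 c14 c23 0 0 a b m n).
Proof.
move=> le_nm P14 P23.
have [->|z14] := eqVneq c14 0; have [->|z23] := eqVneq c23 0.
- scale fXXVI (1 : k) (1 : k) (1 : k) (1 : k)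
    (0 : k) (0 : k) (0 : k) (0 : k) (0 : k) (0 : k).
  by split; [lia | formeq].
- have [e ne] := P23 z23; subst n.
  scale fXVII (1 : k) c23 (1 : k) (1 : k)
    (0 : k) (0 : k) (0 : k) (1 : k) (0 : k) (0 : k).
  by exists e; rewrite pX; split; [lia | lia | formeq].
- have [e me] := P14 z14; subst m.
  scale fXXIV c14 (1 : k) (1 : k) (1 : k)
    (0 : k) (0 : k) (1 : k) (0 : k) (0 : k) (0 : k).
  by exists e; rewrite pX; split; [lia | lia | formeq].
have [e me] := P14 z14; have [f nf] := P23 z23; subst m n.
scale fXV c14 c23 (1 : k) (1 : k)
  (0 : k) (0 : k) (1 : k) (1 : k) (0 : k) (0 : k).
by exists e, f; rewrite -expn_p_le; split; [lia | lia | lia | formeq].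
Qed.

Lemma normalizable_12_14_34 (c12 c14 c34 : k) (a b m n : nat) : (n <= m)%N ->
  (c12 != 0 \/ c34 != 0 -> ppower a /\ (m = n + a.*2)%N) ->
  (c14 != 0 -> ppower m) ->
  normalizable p m n (monomial4 c12 0 c14 0 0 c34 a b m n).
Proof.
move=> le_nm Pa P14.
(* Supplies the inequality between exponents in V, XI and XIX: there p^f = m = n + 2 p^e1 exceeds
   p^e1. *)
have lt_am e1 f : (p ^ f = n + (p ^ e1).*2)%N -> (e1 < f)%N.
  have : (0 < p ^ e1)%N by rewrite expn_gt0 prime_gt0.
  by rewrite -(expn_p_lt e1) => ? ->; lia.
have [-> {P14}|z14] := eqVneq c14 0; last have [f mf] := P14 z14.
  have [z12|z12] := eqVneq c12 0; have [z34|z34] := eqVneq c34 0.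
  - by rewrite z12 z34; apply: normalizable_14_23 => //; rewrite eqxx.
  - have [|[e ae] mE] := Pa; [by right | subst a c12].
    scale fXX (1 : k) (1 : k) c34 (1 : k)
      (0 : k) (0 : k) (0 : k) (0 : k) (0 : k) (1 : k).
    by exists e; rewrite pX; split; [lia | lia | formeq].
  - have [|[e ae] mE] := Pa; [by left | subst a c34].
    scale fXII c12 (1 : k) (1 : k) (1 : k)
      (1 : k) (0 : k) (0 : k) (0 : k) (0 : k) (0 : k).
    by exists e; rewrite pX; split; [lia | lia | formeq].
  have [|[e ae] mE] := Pa; [by left | subst a].
  scale fVI c12 (1 : k) c34 (1 : k)
    (1 : k) (0 : k) (0 : k) (0 : k) (0 : k) (1 : k).
  by exists e; rewrite pX; split; [lia | lia | formeq].
have [z12|z12] := eqVneq c12 0; have [z34|z34] := eqVneq c34 0.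
- by rewrite z12 z34; apply: normalizable_14_23 => //; rewrite eqxx.
- have [|[e ae] mE] := Pa; [by right | subst a c12 m].
  scale fXIX c14 (1 : k) c34 (1 : k)
    (0 : k) (0 : k) (1 : k) (0 : k) (0 : k) (1 : k).
  by exists e, f; rewrite !pX; split; [exact: lt_am | lia | lia | formeq].
- have [|[e ae] mE] := Pa; [by left | subst a c34 m].
  scale fXI c14 (c14 / c12) (1 : k) (1 : k)
    (1 : k) (0 : k) (1 : k) (0 : k) (0 : k) (0 : k).
  by exists e, f; rewrite !pX; split; [exact: lt_am | lia | lia | formeq].
have [|[e ae] mE] := Pa; [by left | subst a m].
scale fV c14 (c14 / c12) c34 (1 : k)
  (1 : k) (0 : k) (1 : k) (0 : k) (0 : k) (1 : k).
by exists e, f; rewrite !pX; split; [exact: lt_am | lia | lia | formeq].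
Qed.

Lemma eq_of_subr (x y x' y' : k) : x' = y' -> x - y = x' - y' -> x = y.
Proof. by move=> -> e; apply/eqP; rewrite -subr_eq0 e subrr. Qed.

Lemma two_expn e : (1 + 1) ^+ (p ^ e) = 1 + 1 :> k.
Proof. by rewrite (frobeniusD pchark) expr1n. Qed.

Lemma odd_pcharP : 2 != 0 :> k -> p = 3%N \/ (5 <= p)%N.
Proof.
move=> k2.
have p2 : p <> 2%N by move=> p2; rewrite -p2 (pcharf0 pchark) eqxx in k2.
by have := p_pr; case: p p2 => [|[|[|[|[|]]]]] //; [left | right].
Qed.

Lemma pchar3_eq0 : p = 3%N -> 3 = 0 :> k.
Proof. by move=> p3; have := pcharf0 pchark; rewrite p3. Qed.

Definition hom4 (c12 c13 c14 c23 c24 c34 : k) (a b m n : nat) :=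
  additive_mx (monomial4 c12 c13 c14 c23 c24 c34 a b m n).

(** * Additivity entry by entry *)

Section Equations.
Variables (c12 c13 c14 c23 c24 c34 : k) (a b m n : nat).
Hypothesis H : hom4 c12 c13 c14 c23 c24 c34 a b m n.

Lemma hom4_12 s t : c12 * (s + t) ^+ a = c12 * s ^+ a + c12 * t ^+ a.
Proof. by have := H s t; rewrite mul_upper4 => /upper4_inj[[]]. Qed.

Lemma hom4_13 s t : c13 * (s + t) ^+ b =
  c13 * s ^+ b + c13 * t ^+ b + c12 * s ^+ a * (c23 * t ^+ n).
Proof. by have := H s t; rewrite mul_upper4 => /upper4_inj[[]]. Qed.

Lemma hom4_14 s t : c14 * (s + t) ^+ m = c14 * s ^+ m + c14 * t ^+ m +
  c12 * s ^+ a * (c24 * t ^+ b) + c13 * s ^+ b * (c34 * t ^+ a).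
Proof. by have := H s t; rewrite mul_upper4 => /upper4_inj[[]]. Qed.

Lemma hom4_23 s t : c23 * (s + t) ^+ n = c23 * s ^+ n + c23 * t ^+ n.
Proof. by have := H s t; rewrite mul_upper4 => /upper4_inj[_ []]. Qed.

Lemma hom4_24 s t : c24 * (s + t) ^+ b =
  c24 * s ^+ b + c24 * t ^+ b + c23 * s ^+ n * (c34 * t ^+ a).
Proof. by have := H s t; rewrite mul_upper4 => /upper4_inj[_ []]. Qed.

Lemma hom4_34 s t : c34 * (s + t) ^+ a = c34 * s ^+ a + c34 * t ^+ a.
Proof. by have := H s t; rewrite mul_upper4 => /upper4_inj[_ []]. Qed.

Lemma ppower_12 : (0 < a)%N -> c12 != 0 -> ppower a.
Proof. by move=> a0 c0; apply: (additive_monomial pchark c0 a0 hom4_12). Qed.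

Lemma ppower_34 : (0 < a)%N -> c34 != 0 -> ppower a.
Proof. by move=> a0 c0; apply: (additive_monomial pchark c0 a0 hom4_34). Qed.

Lemma ppower_23 : (0 < n)%N -> c23 != 0 -> ppower n.
Proof. by move=> a0 c0; apply: (additive_monomial pchark c0 a0 hom4_23). Qed.

Lemma ppower_13 : (0 < b)%N -> c12 * c23 = 0 -> c13 != 0 -> ppower b.
Proof.
move=> b0 z c0; apply: (additive_monomial pchark c0 b0) => s t.
by rewrite hom4_13 mulrACA z mul0r addr0.
Qed.

Lemma ppower_24 : (0 < b)%N -> c23 * c34 = 0 -> c24 != 0 -> ppower b.
Proof.
move=> b0 z c0; apply: (additive_monomial pchark c0 b0) => s t.
by rewrite hom4_24 mulrACA z mul0r addr0.
Qed.

Lemma ppower_14 :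
  (0 < m)%N -> c12 * c24 = 0 -> c13 * c34 = 0 -> c14 != 0 -> ppower m.
Proof.
move=> m0 z z' c0; apply: (additive_monomial pchark c0 m0) => s t.
by rewrite hom4_14 mulrACA z mulrACA z' !mul0r !addr0.
Qed.

Lemma hom4_13_sym : c12 * c23 != 0 -> n = a.
Proof.
move=> nz; apply/eqP; apply: contraNT nz => na; apply/eqP.
pose F s t := c13 * (s + t) ^+ b - c13 * s ^+ b - c13 * t ^+ b.
have an : a <> n by move=> an; rewrite an eqxx in na.
(* The mirrored monomial s^n t^a has coefficient 0, so symmetry yields c12 c23 = 0. *)
apply: (@symmetric_monomials _ F _ 0 a n an) => s t; rewrite /F.
  by rewrite addrC [s + t]addrC; ring.
by rewrite hom4_13; ring.
Qed.

Lemma hom4_24_sym : c23 * c34 != 0 -> n = a.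
Proof.
move=> nz; apply/eqP; apply: contraNT nz => na; apply/eqP.
pose F s t := c24 * (s + t) ^+ b - c24 * s ^+ b - c24 * t ^+ b.
have an : n <> a by move=> an; rewrite an eqxx in na.
apply: (@symmetric_monomials _ F _ 0 n a an) => s t; rewrite /F.
  by rewrite addrC [s + t]addrC; ring.
by rewrite hom4_24; ring.
Qed.

Lemma hom4_14_sym : a <> b -> c12 * c24 = c13 * c34.
Proof.
move=> ab.
pose F s t := c14 * (s + t) ^+ m - c14 * s ^+ m - c14 * t ^+ m.
apply: (@symmetric_monomials _ F _ _ a b ab) => s t; rewrite /F.
  by rewrite addrC [s + t]addrC; ring.
by rewrite hom4_14; ring.
Qed.

End Equations.

(* The equations at s = t = 1, where 2 ^+ (p ^ e) = 2. *)
Lemma hom4_triple e (c12 c13 c14 c23 c24 c34 : k) :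
  hom4 c12 c13 c14 c23 c24 c34 (p ^ e) (2 * p ^ e) (3 * p ^ e) (p ^ e) ->
  [/\ c13 * 2 = c12 * c23, c24 * 2 = c23 * c34
    & c14 * 6 = c12 * c24 + c13 * c34].
Proof.
move=> H; split.
- apply: eq_of_subr (hom4_13 H 1 1) _.
  by rewrite mulnC exprM two_expn !expr1n; ring.
- apply: eq_of_subr (hom4_24 H 1 1) _.
  by rewrite mulnC exprM two_expn !expr1n; ring.
apply: eq_of_subr (hom4_14 H 1 1) _.
by rewrite mulnC exprM two_expn !expr1n; ring.
Qed.

Lemma half_of (x y : k) : 2 != 0 :> k -> x * 2 = y -> x = 2^-1 * y.
Proof. by move=> k2 <-; rewrite mulrC mulfK. Qed.

(** Here n = a = q, and 2 c13 = c12 c23 excludes p = 2. Then 6 c14 = c12 c23 c34 splits the rest: p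
    = 3 kills c34 and leaves II or III according to c14, while p >= 5 leaves I or III according to
    c34. *)
Lemma normalizable_12_23 (c12 c13 c14 c23 c24 c34 : k) (a b m n : nat) :
  (0 < a)%N -> b = (n + a)%N -> m = (a + b)%N ->
  hom4 c12 c13 c14 c23 c24 c34 a b m n -> c12 != 0 -> c23 != 0 ->
  normalizable p m n (monomial4 c12 c13 c14 c23 c24 c34 a b m n).
Proof.
move=> a0 bE mE H z12 z23.
have [e ae] := ppower_12 H a0 z12.
have na := hom4_13_sym H (mulf_neq0 z12 z23); subst a n.
have {}bE : b = (2 * p ^ e)%N by lia.
have {}mE : m = (3 * p ^ e)%N by lia.
subst b m; have [e13 e24 e14] := hom4_triple H.
have k2 : 2 != 0 :> k.
  by apply: contraNneq (mulf_neq0 z12 z23) => k2; rewrite -e13 k2 mulr0.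
have {}e13 := half_of k2 e13; have {}e24 := half_of k2 e24.
have {}e14 : c14 * 6 = c12 * c23 * c34.
  by rewrite e14 e13 e24; field.
have III : c34 = 0 -> c14 = 0 -> normalizable p (3 * p ^ e) (p ^ e)
    (monomial4 c12 c13 c14 c23 c24 c34 (p ^ e) (2 * p ^ e) (3 * p ^ e) (p ^ e)).
  move=> z34 z14; subst c34 c13 c24 c14.
  scale fIII (c12 * c23) c23 (1 : k) (1 : k)
    (1 : k) (2^-1 : k) (0 : k) (1 : k) (0 : k) (0 : k).
  split; first by have [->|/ltnW/ltnW] := odd_pcharP k2.
  by exists e; rewrite pX; split; [lia | lia | formeq].
have [p3|p5] := odd_pcharP k2.
  have k6 : 6 = 0 :> k by rewrite (natrM k 2 3) (pchar3_eq0 p3) mulr0.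
  have z34 : c34 = 0.
    apply/eqP; move/eqP: e14; rewrite k6 mulr0 eq_sym !mulf_eq0.
    by rewrite (negPf z12) (negPf z23).
  have [z14|z14] := eqVneq c14 0; first exact: III.
  have eS : (3 * p ^ e = p ^ e.+1)%N by rewrite expnS p3.
  subst c34 c13 c24; rewrite eS.
  (* The three ratios are spent on entries (1,2), (2,3) and (1,4); the relation for c13 then
     produces the coefficient 1/2 by itself. *)
  scale fII (c12 * c23) c23 (1 : k) (c12 * c23 / c14)
    (1 : k) (2^-1 : k) (1 : k) (1 : k) (0 : k) (0 : k).
  by split=> //; exists e; rewrite !pX; split; [lia | lia | formeq].
have k6 := neq6_pchar pchark p5.
have {}e14 : c14 = 6^-1 * (c12 * c23 * c34) by rewrite -e14 mulrC mulfK.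
have [z34|z34] := eqVneq c34 0.
  by apply: III => //; rewrite e14 z34 !mulr0.
subst c13 c24 c14.
scale fI (c12 * c23 * c34) (c23 * c34) c34 (1 : k)
  (1 : k) (2^-1 : k) (6^-1 : k) (1 : k) (2^-1 : k) (1 : k).
by split=> //; exists e; rewrite pX; split; [lia | lia | formeq].
Qed.

(** The mirror image, with c12 = 0. Then c13 = 0 and 6 c14 = 0, so c14 survives only for p = 3,
    which separates VII from VIII. *)
Lemma normalizable_23_34 (c13 c14 c23 c24 c34 : k) (a b m n : nat) :
  (0 < a)%N -> b = (n + a)%N -> m = (a + b)%N ->
  hom4 0 c13 c14 c23 c24 c34 a b m n -> c23 != 0 -> c34 != 0 ->
  normalizable p m n (monomial4 0 c13 c14 c23 c24 c34 a b m n).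
Proof.
move=> a0 bE mE H z23 z34.
have [e ae] := ppower_34 H a0 z34.
have na := hom4_24_sym H (mulf_neq0 z23 z34); subst a n.
have {}bE : b = (2 * p ^ e)%N by lia.
have {}mE : m = (3 * p ^ e)%N by lia.
subst b m; have [e13 e24 e14] := hom4_triple H.
have k2 : 2 != 0 :> k.
  by apply: contraNneq (mulf_neq0 z23 z34) => k2; rewrite -e24 k2 mulr0.
have {}e13 := half_of k2 e13; have {}e24 := half_of k2 e24.
rewrite mul0r mulr0 in e13; rewrite e13 !mul0r addr0 in e14.
subst c13 c24.
have [z14|z14] := eqVneq c14 0.
  subst c14; scale fVIII (1 : k) (c23 * c34) c34 (1 : k)
    (0 : k) (0 : k) (0 : k) (1 : k) (2^-1 : k) (1 : k).
  split; first by have [->|/ltnW/ltnW] := odd_pcharP k2.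
  by exists e; rewrite pX; split; [lia | lia | formeq].
have [p3|p5] := odd_pcharP k2; last first.
  by have := mulf_neq0 z14 (neq6_pchar pchark p5); rewrite e14 eqxx.
have eS : (3 * p ^ e = p ^ e.+1)%N by rewrite expnS p3.
rewrite eS; scale fVII c14 (c23 * c34) c34 (1 : k)
  (0 : k) (0 : k) (1 : k) (1 : k) (2^-1 : k) (1 : k).
by split=> //; exists e; rewrite !pX; split; [lia | lia | formeq].
Qed.

(** No mixed terms remain, so every nonzero entry has a power of p as exponent. If c13 or c24 is
    nonzero, then m = 2b - n with powers b > n of p, which is not a power of p, and c14 must
    vanish. *)
Lemma normalizable_23 (c13 c14 c23 c24 : k) (a b m n : nat) :
  (0 < a)%N -> (0 < n)%N -> b = (n + a)%N -> m = (a + b)%N ->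
  hom4 0 c13 c14 c23 c24 0 a b m n -> c23 != 0 ->
  normalizable p m n (monomial4 0 c13 c14 c23 c24 0 a b m n).
Proof.
move=> a0 n0 bE mE H z23.
have m0 : (0 < m)%N by lia.
have b0 : (0 < b)%N by lia.
have P14 := ppower_14 H m0 (mul0r _) (mulr0 _).
have P23 := ppower_23 H n0.
have [e3 nE] := P23 z23.
have P13 := ppower_13 H b0 (mul0r _).
have P24 := ppower_24 H b0 (mulr0 _).
have [/andP[/eqP z13 /eqP z24]|nz] := boolP ((c13 == 0) && (c24 == 0)).
  by rewrite z13 z24; apply: normalizable_14_23 => //; lia.
have [e1 bp] : ppower b.
  by move: nz; rewrite negb_and => /orP[].
have lt31 : (e3 < e1)%N by rewrite -expn_p_lt; lia.
have z14 : c14 = 0.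
  apply/eqP; apply: contraTT isT => /P14[f mp].
  by case: (expn_addn_neq_double p_pr lt31 (f := f)); lia.
have {}mE : m = (2 * p ^ e1 - p ^ e3)%N by lia.
have lt31' : (p ^ e3 < p ^ e1)%N by lia.
have mZ : m%:Z = 2 * (p ^ e1)%N%:Z - (p ^ e3)%N%:Z by lia.
clear mE bE; subst b n c14.
have [z13|z13] := eqVneq c13 0; have [z24|z24] := eqVneq c24 0.
- by rewrite z13 z24 eqxx in nz.
- subst c13; scale fXVI (1 : k) c24 (c24 / c23) (1 : k)
    (0 : k) (0 : k) (0 : k) (1 : k) (1 : k) (0 : k).
  by exists e3, e1; rewrite !pX; split; [lia | lia | lia | formeq].
- subst c24; scale fXIV c13 c23 (1 : k) (1 : k)
    (0 : k) (1 : k) (0 : k) (1 : k) (0 : k) (0 : k).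
  by exists e1, e3; rewrite !pX; split; [lia | lia | lia | formeq].
scale fXIII c13 c23 (1 : k) (c23 / c24)
  (0 : k) (1 : k) (0 : k) (1 : k) (1 : k) (0 : k).
by exists e1, e3; rewrite !pX; split; [lia | lia | lia | formeq].
Qed.

Lemma normalizable_23_eq0 (c12 c13 c14 c24 c34 : k) (a b m n : nat) :
  (0 < a)%N -> (0 < n)%N -> b = (n + a)%N -> m = (a + b)%N ->
  hom4 c12 c13 c14 0 c24 c34 a b m n ->
  normalizable p m n (monomial4 c12 c13 c14 0 c24 c34 a b m n).
Proof.
move=> a0 n0 bE mE H.
have m0 : (0 < m)%N by lia.
have b0 : (0 < b)%N by lia.
have le_nm : (n <= m)%N by lia.
have mE' : m = (n + a.*2)%N by lia.
have ab : a <> b by lia.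
have Pa : c12 != 0 \/ c34 != 0 -> ppower a.
  by case; [exact: ppower_12 H a0 | exact: ppower_34 H a0].
have P13 := ppower_13 H b0 (mulr0 _).
have P24 := ppower_24 H b0 (mul0r _).
have dot := hom4_14_sym H ab.
(* Without mixed terms a nonzero c14 makes m a power of p, yet b < m = a + b < 2b with b itself a
   power of p. *)
have z14 : c12 * c24 = 0 -> ppower b -> c14 = 0.
  move=> z [e be]; apply/eqP; apply: contraTT isT.
  have z' : c13 * c34 = 0 by rewrite -dot.
  move=> /(ppower_14 H m0 z z')[f mf].
  have : (e < f)%N by rewrite -expn_p_lt; lia.
  by move/(expn_double_le pchark); lia.
have [z13|z13] := eqVneq c13 0; have [z24|z24] := eqVneq c24 0.
- subst c13 c24; apply: normalizable_12_14_34 => //; first by move/Pa.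
  by apply: ppower_14 H m0 _ _; rewrite ?mulr0 ?mul0r.
- have z12 : c12 = 0.
    by apply/eqP; move/eqP: dot; rewrite z13 mul0r mulf_eq0 (negPf z24) orbF.
  have [e2 be] := P24 z24.
  have [z34|z34] := eqVneq c34 0.
    have z14' : c14 = 0 by apply: z14; rewrite ?z12 ?mul0r //; exists e2.
    subst c12 c13 c14 c34; rewrite be; scale fXXV (1 : k) c24 (1 : k) (1 : k)
      (0 : k) (0 : k) (0 : k) (0 : k) (1 : k) (0 : k).
    by exists e2; rewrite pX; split; [lia | lia | formeq].
  have [e1 ae] := Pa (or_intror z34).
  have lt12 : (e1 < e2)%N by rewrite -expn_p_lt; lia.
  rewrite z14 ?z12 ?mul0r //; last by exists e2.
  subst c12 c13; rewrite ae be.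
  scale fXVIII (1 : k) c24 c34 (1 : k)
    (0 : k) (0 : k) (0 : k) (0 : k) (1 : k) (1 : k).
  by exists e1, e2; rewrite !pX; split; [lia | lia | lia | formeq].
- have z34 : c34 = 0.
    by apply/eqP; move/esym/eqP: dot; rewrite z24 mulr0 mulf_eq0 (negPf z13).
  have [e2 be] := P13 z13.
  have [z12|z12] := eqVneq c12 0.
    have z14' : c14 = 0 by apply: z14; rewrite ?z12 ?mul0r //; exists e2.
    subst c12 c24 c14 c34; rewrite be; scale fXXIII c13 (1 : k) (1 : k) (1 : k)
      (0 : k) (1 : k) (0 : k) (0 : k) (0 : k) (0 : k).
    by exists e2; rewrite pX; split; [lia | lia | formeq].
  have [e1 ae] := Pa (or_introl z12).
  have lt12 : (e1 < e2)%N by rewrite -expn_p_lt; lia.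
  rewrite z14 ?z24 ?mulr0 //; last by exists e2.
  subst c34 c24; rewrite ae be.
  scale fX (1 : k) c12^-1 c13^-1 (1 : k)
    (1 : k) (1 : k) (0 : k) (0 : k) (0 : k) (0 : k).
  by exists e1, e2; rewrite !pX; split; [lia | lia | lia | formeq].
have [e2 be] := P13 z13.
have [z12|z12] := eqVneq c12 0.
  have z34 : c34 = 0.
    by apply/eqP; move/esym/eqP: dot; rewrite z12 mul0r mulf_eq0 (negPf z13).
  have z14' : c14 = 0 by apply: z14; rewrite ?z12 ?mul0r //; exists e2.
  subst c12 c14 c34; rewrite be; scale fXXII c13 c24 (1 : k) (1 : k)
    (0 : k) (1 : k) (0 : k) (0 : k) (1 : k) (0 : k).
  by exists e2; rewrite pX; split; [lia | lia | formeq].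
have [e1 ae] := Pa (or_introl z12).
have lt12 : (e1 < e2)%N by rewrite -expn_p_lt; lia.
(* Since a and b are powers of p, (s + 1)^m = (s^a + 1)(s^b + 1); at t = 1 the (1,4) identity
   compares the coefficients of s^a and s^b. *)
have e14 : c14 = c12 * c24.
  have [s s0|z _] :=
    @two_monomials _ (c14 - c12 * c24) (c12 * c24 - c14) a b ab.
    have := hom4_14 H s 1; rewrite {1}mE exprD {1}ae {1}be.
    rewrite !(frobeniusD pchark) -ae -be mE exprD !expr1n.
    rewrite (mulrACA c13) -dot => e14; by apply: eq_of_subr e14 _; ring.
  by apply/eqP; rewrite -subr_eq0 z.
subst c14; have z34 : c34 != 0.
  apply: contraTneq (mulf_neq0 z12 z24) => z34.
  by rewrite dot z34 mulr0 eqxx.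
have e34 : c34 = c12 * c24 / c13 by rewrite dot mulrAC mulfV // mul1r.
subst c34; rewrite mE ae be; scale fIV (c12 * c24) c24 (c12 * c24 / c13) (1 : k)
  (1 : k) (1 : k) (1 : k) (0 : k) (1 : k) (1 : k).
by exists e1, e2; rewrite !pX; split; [lia | lia | lia | formeq].
Qed.

(** A matrix Q in the middle GL_2 sends the row (c12, c13) to its product with Q and the column
    (c24, c34) to its product with the inverse of Q, so c12 c24 + c13 c34 is invariant. With c13 = 0
    it is c12 c24: if nonzero, the form is IX; if zero, c24 can be removed as well. *)
Lemma normalizable_middle_eq0 (c12 c14 c24 c34 : k) (a m : nat) :
  (0 < a)%N -> m = a.*2 -> hom4 c12 0 c14 0 c24 c34 a a m 0 ->
  normalizable p m 0 (monomial4 c12 0 c14 0 c24 c34 a a m 0).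
Proof.
move=> a0 mE H; have m0 : (0 < m)%N by lia.
have outer z12 z34 : hom4 z12 0 c14 0 0 z34 a a m 0 ->
    normalizable p m 0 (monomial4 z12 0 c14 0 0 z34 a a m 0).
  move=> {}H; apply: normalizable_12_14_34 => //.
    by case=> [/(ppower_12 H a0)|/(ppower_34 H a0)].
  by apply: ppower_14 H m0 _ _; rewrite ?mulr0 ?mul0r.
have [z24|z24] := eqVneq c24 0; first by rewrite z24 in H *; apply: outer.
have [z12|z12] := eqVneq c12 0.
  subst c12; have [z34|z34] := eqVneq c34 0.
    (* Swapping the two middle basis vectors moves the lone entry (2,4) to (3,4). *)
    apply: (@normalizable_middle _ _ _ _ _ _ _ 0 1 1 0 0 0 0 c24
      _ _ _ _ _ _ _ H);
      [|ring|ring|ring|rewrite z34; ring|exact: outer].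
    by rewrite mul0r mul1r sub0r oppr_eq0 oner_eq0.
  apply: (@normalizable_middle _ _ _ _ _ _ _ 1 (c24 / c34) 0 1 0 0 0 c34
    _ _ _ _ _ _ _ H); [|ring|ring|by field|ring|exact: outer].
  by rewrite mulr0 mul1r subr0 oner_eq0.
apply: (@normalizable_middle _ _ _ _ _ _ _ 1 0 (c34 / c24) 1 c12 0 c24 0
  _ _ _ _ _ _ _ H); [|ring|ring|ring|by field|].
  by rewrite mul0r mul1r subr0 oner_eq0.
move=> {}H; have [e ae] := ppower_12 H a0 z12.
have {}mE : m = (2 * p ^ e)%N by lia.
subst a m.
have e14 : c14 * 2 = c12 * c24.
  apply: eq_of_subr (hom4_14 H 1 1) _.
  by rewrite mulnC exprM two_expn !expr1n; ring.
have k2 : 2 != 0 :> k.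
  by apply: contraNneq (mulf_neq0 z12 z24) => k2; rewrite -e14 k2 mulr0.
have {}e14 := half_of k2 e14; subst c14.
scale fIX (c12 * c24) c24 (1 : k) (1 : k)
  (1 : k) (0 : k) (2^-1 : k) (0 : k) (1 : k) (0 : k).
split; first by have [->|/ltnW/ltnW] := odd_pcharP k2.
by exists e; rewrite pX; split; [lia | lia | formeq].
Qed.

(** The middle GL_2 can bring the row (c12, c13) to one with second entry 0: by a swap if c12 = 0,
    by a shear otherwise. *)
Lemma normalizable_n0 (c12 c13 c14 c24 c34 : k) (a m : nat) :
  (0 < a)%N -> m = a.*2 -> hom4 c12 c13 c14 0 c24 c34 a a m 0 ->
  normalizable p m 0 (monomial4 c12 c13 c14 0 c24 c34 a a m 0).
Proof.
move=> a0 mE H; have [z13|z13] := eqVneq c13 0.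
  by rewrite z13 in H *; apply: normalizable_middle_eq0.
have [z12|z12] := eqVneq c12 0.
  apply: (@normalizable_middle _ _ _ _ _ _ _ 0 1 1 0 c13 0 c34 c24
    _ _ _ _ _ _ _ H);
    [|rewrite z12; ring|rewrite z12; ring|ring|ring
     |exact: normalizable_middle_eq0].
  by rewrite mul0r mul1r sub0r oppr_eq0 oner_eq0.
apply: (@normalizable_middle _ _ _ _ _ _ _ 1 (- c13 / c12) 0 1 c12 0
  (c24 + c13 / c12 * c34) c34 _ _ _ _ _ _ _ H);
  [|ring|by field|by field|ring|exact: normalizable_middle_eq0].
by rewrite mulr0 mul1r subr0 oner_eq0.
Qed.

(** The upper right 2 x 2 block C changes to Q^-1 C R with Q and R independent, so Gaussian
    elimination makes it antidiagonal. The pivot is c14, else c13, else c24; with pivot c14 the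
    remaining entry is the Schur complement. *)
Lemma normalizable_a0 (c13 c14 c23 c24 : k) (m : nat) : (0 < m)%N ->
  hom4 0 c13 c14 c23 c24 0 0 m m m ->
  normalizable p m m (monomial4 0 c13 c14 c23 c24 0 0 m m m).
Proof.
move=> m0 H.
have anti z14 z23 : hom4 0 0 z14 z23 0 0 0 m m m ->
    normalizable p m m (monomial4 0 0 z14 z23 0 0 0 m m m).
  move=> {}H; apply: normalizable_14_23 => //.
    by apply: ppower_14 H m0 _ _; rewrite mul0r.
  exact: ppower_23 H m0.
have D1 (x : k) : 1 * 1 - 0 * x != 0 by rewrite mul0r mul1r subr0 oner_eq0.
have D2 : 0 * 0 - 1 * 1 != 0 :> k.
  by rewrite mul0r mul1r sub0r oppr_eq0 oner_eq0.
have [z14|z14] := eqVneq c14 0; last first.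
  apply: (@normalizable_block _ _ _ _ _ _ 1 0 (c24 / c14) 1
    1 0 (- c13 / c14) 1 0 c14 (c23 - c24 * c13 / c14) 0
    _ (D1 _) (D1 _) _ _ _ _ H);
    [by field|ring|by field|by field|exact: anti].
have [z13|z13] := eqVneq c13 0; last first.
  apply: (@normalizable_block _ _ _ _ _ _ 1 0 (c23 / c13) 1
    0 1 1 0 0 c13 c24 0 _ (D1 _) D2 _ _ _ _ H);
    [rewrite z14; ring|ring|by field|by field|exact: anti].
have [z24|z24] := eqVneq c24 0.
  by rewrite z13 z24 in H *; apply: anti.
apply: (@normalizable_block _ _ _ _ _ _ 0 1 1 0
    1 0 (- c23 / c24) 1 0 c24 0 0 _ D2 (D1 _) _ _ _ _ H);
  [rewrite z13 z14; ring|rewrite z14; ring|by field|by field|exact: anti].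
Qed.

(** The zero exponents a = 0 and n = 0 mark the weights d1 = d2 and d2 = 0, where the centralizer is
    larger than the diagonal torus. The positivity hypotheses dispose of the trivial weight m =
    0. *)
Lemma normalizable_hom4 (c12 c13 c14 c23 c24 c34 : k) (a b m n : nat) :
  b = (n + a)%N -> m = (a + b)%N ->
  (c12 != 0 \/ c34 != 0 -> (0 < a)%N) -> (c13 != 0 \/ c24 != 0 -> (0 < b)%N) ->
  (c14 != 0 -> (0 < m)%N) -> (c23 != 0 -> (0 < n)%N) ->
  hom4 c12 c13 c14 c23 c24 c34 a b m n ->
  normalizable p m n (monomial4 c12 c13 c14 c23 c24 c34 a b m n).
Proof.
move=> bE mE P12 P13 P14 P23 H.
have [a0|a_gt0] := posnP a.
  have z12 : c12 = 0.
    by apply/eqP; apply: contraT => nz; move: (P12 (or_introl nz)); rewrite a0.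
  have z34 : c34 = 0.
    by apply/eqP; apply: contraT => nz; move: (P12 (or_intror nz)); rewrite a0.
  have bm : b = m by lia.
  have nm : n = m by lia.
  rewrite a0 nm bm z12 z34 {mE bE P12 a0 bm} in P13 P14 P23 H *.
  have [m0|m_gt0] := posnP m; last exact: normalizable_a0.
  have z13 : c13 = 0.
    by apply/eqP; apply: contraT => nz; move: (P13 (or_introl nz)); rewrite m0.
  have z24 : c24 = 0.
    by apply/eqP; apply: contraT => nz; move: (P13 (or_intror nz)); rewrite m0.
  rewrite z13 z24; apply: normalizable_14_23 => // nz.
    by move: (P14 nz); rewrite m0.
  by move: (P23 nz); rewrite m0.
have [n0|n_gt0] := posnP n.
  have z23 : c23 = 0.
    by apply/eqP; apply: contraT => nz; move: (P23 nz); rewrite n0.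
  have ba : b = a by lia.
  have {}mE : m = a.*2 by lia.
  by rewrite n0 ba z23 in H *; apply: normalizable_n0.
have [z23|z23] := eqVneq c23 0.
  by rewrite z23 in H *; apply: normalizable_23_eq0.
have [z12|z12] := eqVneq c12 0; last exact: normalizable_12_23.
rewrite z12 in H *.
have [z34|z34] := eqVneq c34 0; last exact: normalizable_23_34.
by rewrite z34 in H *; apply: normalizable_23.
Qed.

End Classification.

Lemma upper_unitriangularE (k : fieldType) (A : 'M[k]_4) :
  (forall i, A i i = 1) -> (forall i j : 'I_4, (j < i)%N -> A i j = 0) ->
  A = upper4 (A (inord 0) (inord 1)) (A (inord 0) (inord 2))
    (A (inord 0) (inord 3)) (A (inord 1) (inord 2)) (A (inord 1) (inord 3))
    (A (inord 2) (inord 3)).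
Proof.
move=> A1 A0; apply/matrixP => i j; rewrite -[i]inord_val -[j]inord_val.
by case: i j => -[|[|[|[|//]]]] ? [[|[|[|[|//]]]] ?];
  rewrite /= /upper4 /mx4 mxE !inordK //= ?A1 // A0 ?inordK.
Qed.

(** * From a homomorphism to its normal form *)

Section Reduction.
Variables (k : closedFieldType) (p : nat) (pchark : p \in [pchar k]).
Variables (phi : Ga k -> SL k 4) (omega : Gm k -> SL k 4) (m n : nat).
Hypothesis phiU : in_U phi.
Hypothesis le_nm : (n <= m)%N.
Hypothesis omegaE : forall u : Gm k, omega u = diag4 m n (Gm_val u) :> 'M_4.
Hypothesis psiM : {morph psi_pair phi omega : x y / (x * y)%g}.

Lemma pair_normalizable : normalizable p m n (fun t : k => phi t).
Proof.
have omegaE' u := etrans (omegaE u) (diag4E m n (Gm_val u)).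
have [phi_hom phi_upper] := phiU.
have mono := pair_hom_monomial phi_hom omegaE' psiM.
have w_ij (i j : nat) : (i < j < 4)%N ->
    weight4 m n (inord j) <= weight4 m n (inord i).
  move=> /andP[ij j4]; rewrite /weight4 !inordK //; last exact: ltn_trans ij _.
  by case: j i ij j4 => [|[|[|[|]]]] [|[|[|]]] //=; lia.
have ne_ij (i j : nat) : (i < j < 4)%N -> inord i != inord j :> 'I_4.
  move=> /andP[ij j4]; rewrite -val_eqE /= !inordK //;
    last exact: ltn_trans ij _.
  by rewrite neq_ltn ij.
have get i j (ij : (i < j < 4)%N) := mono _ _ (ne_ij i j ij) (w_ij i j ij).
have [c12 [e12 w12]] := get 0%N 1%N isT.
have [c13 [e13 w13]] := get 0%N 2%N isT.
have [c14 [e14 w14]] := get 0%N 3%N isT.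
have [c23 [e23 w23]] := get 1%N 2%N isT.
have [c24 [e24 w24]] := get 1%N 3%N isT.
have [c34 [e34 w34]] := get 2%N 3%N isT.
rewrite /weight4 !inordK //= in e12 w12 e13 w13 e14 w14 e23 w23 e24 w24 e34 w34.
(* These halves are truncated; they are exact when m - n is even, and otherwise the entries carrying
   them vanish. *)
pose a := (m - n)./2; pose b := (m + n)./2.
have E12 : `|m%:Z - n%:Z|./2 = a by rewrite distnEl.
have E13 : `|m%:Z - - n%:Z|./2 = b by rewrite opprK -PoszD absz_nat.
have E14 : `|m%:Z - - m%:Z|./2 = m.
  by rewrite opprK -PoszD absz_nat addnn doubleK.
have E23 : `|n%:Z - - n%:Z|./2 = n.
  by rewrite opprK -PoszD absz_nat addnn doubleK.
have E24 : `|n%:Z - - m%:Z|./2 = b.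
  by rewrite opprK -PoszD absz_nat addnC.
have E34 : `|- n%:Z - - m%:Z|./2 = a by rewrite opprK addrC distnEl.
rewrite {}E12 in e12 w12; rewrite {}E13 in e13 w13; rewrite {}E14 in e14 w14.
rewrite {}E23 in e23 w23; rewrite {}E24 in e24 w24; rewrite {}E34 in e34 w34.
have phiE (t : k) : phi t = monomial4 c12 c13 c14 c23 c24 c34 a b m n t :> 'M_4.
  have [phi1 phi0] := phi_upper t.
  by rewrite [LHS](upper_unitriangularE phi1 phi0) e12 e13 e14 e23 e24 e34.
have H : hom4 c12 c13 c14 c23 c24 c34 a b m n.
  by move=> s t; rewrite -!phiE; have -> := phi_hom.2 s t.
suff [P [M' [nu [uP dP MP form]]]] :
    normalizable p m n (monomial4 c12 c13 c14 c23 c24 c34 a b m n).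
  by exists P, M', nu; split=> // t; rewrite phiE.
have [ev|od] := boolP (~~ odd (m - n)).
  have bE : b = (n + a)%N by move: ev le_nm; rewrite /a /b; clear; lia.
  have mE : m = (a + b)%N by move: ev le_nm; rewrite /a /b; clear; lia.
  apply: (normalizable_hom4 pchark bE mE _ _ _ _ H).
  - by case=> [/w12|/w34] [].
  - by case=> [/w13|/w24] [].
  - by case/w14.
  - by case/w23.
(* Now d1 - d2 and d1 + d2 are odd, whereas a nonzero entry needs an even weight difference; only
   (1,4) and (2,3), with differences 2m and 2n, survive. *)
have z12 : c12 = 0.
  by apply/eqP; apply: contraT => /w12[_]; move: od; rewrite /a; clear; lia.
have z34 : c34 = 0.
  by apply/eqP; apply: contraT => /w34[_]; move: od; rewrite /a; clear; lia.
have z13 : c13 = 0.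
  apply/eqP; apply: contraT => /w13[_].
  by move: od le_nm; rewrite /b; clear; lia.
have z24 : c24 = 0.
  apply/eqP; apply: contraT => /w24[_].
  by move: od le_nm; rewrite /b; clear; lia.
rewrite z12 z13 z24 z34 in H *.
apply: (normalizable_14_23 pchark) => // nz.
  by apply: (ppower_14 pchark H _ _ _ nz); rewrite ?mul0r //; case/w14: nz.
by apply: (ppower_23 pchark H _ nz); case/w23: nz.
Qed.

Lemma pair_has_normal_form :
  exists (phi' : Ga k -> SL k 4) (omega' : Gm k -> SL k 4),
    [/\ in_U phi', in_Omega omega', equiv_pair phi omega phi' omega'
      & exists nu : form_label, has_form p nu phi' omega'].
Proof.
have [P [M' [nu [uP dP MP form]]]] := pair_normalizable.
(* Taking determinants in phi(t) P = P M'(t) and cancelling det P makes [M'] a map into SL(4). *)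
have detM (t : k) : \det (M' t) == 1.
  have := congr1 (fun A => \det A) (MP t).
  rewrite !det_mulmx (eqP (SL_det _)) mul1r -[LHS]mulr1.
  by move/(mulrI _)/esym/eqP; apply; rewrite -unitmxE.
exists (fun t : Ga k => MkSL (detM t)), omega.
have nuP : has_form p nu (fun t : Ga k => MkSL (detM t)) omega.
  by exists m%:Z, n%:Z; split.
have [U' O' _] := has_form_hom pchark nuP; split=> //; last by exists nu.
exists P => // -[t u]; apply: (can_inj (mulKmx uP)).
rewrite !mulmxA mulmxV // mul1mx /= -mulmxA omegaE dP ?Gm_neq0 //.
by rewrite !mulmxA MP.
Qed.

End Reduction.

Theorem theorem3p1 (k : closedFieldType) (p : nat) (pchark : p \in [pchar k]) :
  (forall (nu : form_label) (phi' : Ga k -> SL k 4) (omega' : Gm k -> SL k 4),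
      has_form p nu phi' omega' ->
      alg_hom (psi_pair phi' omega') /\ in_Omega omega')
  /\
  (forall (psi : B2 k -> SL k 4)
          (phi : Ga k -> SL k 4) (omega : Gm k -> SL k 4),
      antisymmetric_hom psi ->
      in_U phi -> in_Omega omega ->
      (forall x : GaGm k, psi (jmath x) = psi_pair phi omega x) ->
      exists (phi' : Ga k -> SL k 4) (omega' : Gm k -> SL k 4),
        [/\ in_U phi', in_Omega omega',
            equiv_pair phi omega phi' omega'
          & exists nu : form_label, has_form p nu phi' omega']).
Proof.
split=> [nu phi omega /(has_form_hom pchark)[] //|].
move=> psi phi omega [[_ psiM] _] phiU /in_Omega4P[d1 [d2 [d12 omE]]] psiE.
have [m mE] : exists m : nat, d1 = m%:Z by exists `|d1|%N; lia.
have [n nE] : exists n : nat, d2 = n%:Z by exists `|d2|%N; lia.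
subst d1 d2; apply: (pair_has_normal_form pchark (m := m) (n := n)) => //.
by move=> x y; rewrite -!psiE jmath_morph psiM.
Qed.
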